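(* Let $\nu>0$, $f\in L^2(Q_T)$, $u_0\in L^2(\Omega)$, $\Upsilon\in L^2(0,T;H_0^1(\Omega))$. There is a constant $C>0$ depending only on $q$ (in particular independent of $h,\tau,T,\nu$) such that any $u_{h\tau}\in\mathring{\mathcal V}_{h\tau}^{\mathsf{disc}(q)}$ satisfying $$\mathcal B_{h\tau}(u_{h\tau},v_{h\tau})=(f,v_{h\tau})_{Q_T}+\nu(\nabla\Upsilon,\nabla v_{h\tau})_{Q_T}+(u_0,v_{h\tau}(\cdot,0))_\Omega\qquad\forall v_{h\tau}\in\mathring{\mathcal V}_{h\tau}^{\mathsf{disc}(q)}$$ satisfies $$\|u_{h\tau}\|_{L^\infty(0,T;L^2(\Omega))}^2+\nu\|\nabla u_{h\tau}\|_{L^2(Q_T)^d}^2+|u_{h\tau}|_{\mathsf J}^2\le C\Big(\|f\|_{L^1(0,T;L^2(\Omega))}^2+\nu\|\nabla\Upsilon\|_{L^2(Q_T)^d}^2+\|u_0\|_{L^2(\Omega)}^2\Big).$$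
   Context: Setting: $\Omega\subset\mathbb R^d$ ($d\in\{1,2,3\}$) is a polytopic domain, $T>0$, $Q_T=\Omega\times(0,T)$. $\mathcal T_h$ is a shape-regular conforming simplicial mesh of $\Omega$ with meshsize $h$. $0=t_0<t_1<\dots<t_N=T$ is an arbitrary partition (no quasi-uniformity), $I_n=(t_{n-1},t_n)$, $\tau_n=t_n-t_{n-1}$, $\tau=\max_n\tau_n$, $Q_n=\Omega\times I_n$. $(\cdot,\cdot)_D$ is the $L^2(D)$ inner product. Integers $p\ge1$, $q\ge0$ are given. Spaces: $\mathring{\mathcal V}_h^p=\{v_h\in H_0^1(\Omega): v_h|_K\in\mathbb P^p(K)\ \forall K\in\mathcal T_h\}$; $\mathring{\mathcal V}_{h\tau}^{\mathsf{disc}(q)}$ is the space of functions whose restriction to each $Q_n$ lies in $\mathbb P^q(I_n)\otimes\mathring{\mathcal V}_h^p$ (no continuity in time across the $t_n$). Jumps: $[\![v]\!]_n=v(t_n^+)-v(t_n^-)$ for $n=1,\dots,N-1$. Values at $t=0$ and $t=T$ are the one-sided traces from inside $(0,T)$. Jump seminorm: $|v|_{\mathsf J}^2=\|v(\cdot,T)\|_{L^2(\Omega)}^2+\sum_{n=1}^{N-1}\|[\![v]\!]_n\|_{L^2(\Omega)}^2+\|v(\cdot,0)\|_{L^2(\Omega)}^2$. Bilinear form (discontinuous Galerkin time discretization of the heat equation $\partial_tu-\nu\Delta u=f$): $$\mathcal B_{h\tau}(u,v)=\sum_{n=1}^N(\partial_tu,v)_{Q_n}+\sum_{n=1}^{N-1}([\![u]\!]_n,v(\cdot,t_n^+))_\Omega+(u(\cdot,0),v(\cdot,0))_\Omega+\nu(\nabla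 u,\nabla v)_{Q_T}.$$ *)

(* Defs.v *)
From HB Require Import structures.
From mathcomp Require Import all_boot all_order all_algebra.
From mathcomp Require Import all_classical all_reals all_analysis.

Set Implicit Arguments.
Unset Strict Implicit.
Unset Printing Implicit Defensive.

Import Order.TTheory GRing.Theory Num.Theory.
Import numFieldNormedType.Exports.

Local Open Scope classical_set_scope.
Local Open Scope ring_scope.

(* R^d carries the sigma-algebra generated by the coordinates, i.e. its Borel
   sigma-algebra. *)
Definition rV_display : measure_display.
Proof. exact: default_measure_display. Qed.

Section measurable_rV.
Context {R : realType} (d : nat).

Definition rV_coord (i : 'I_d) (x : 'rV[R]_d) : R := x 0 i.

Let rV_set0 : g_sigma_preimage rV_coord set0.
Proof. exact: sigma_algebra0. Qed.

Let rV_setC A : g_sigma_preimage rV_coord A -> g_sigma_preimage rV_coord (~` A).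
Proof. exact: sigma_algebraC. Qed.

Let rV_bigcup (F : (set 'rV[R]_d)^nat) :
  (forall i, g_sigma_preimage rV_coord (F i)) ->
  g_sigma_preimage rV_coord (\bigcup_i F i).
Proof. exact: sigma_algebra_bigcup. Qed.

HB.instance Definition _ :=
  @isMeasurable.Build rV_display 'rV[R]_d (g_sigma_preimage rV_coord)
    rV_set0 rV_setC rV_bigcup.

End measurable_rV.

Lemma measurable_rV_coord (R : realType) d (i : 'I_d) :
  measurable_fun [set: 'rV[R]_d] (rV_coord i).
Proof.
case: d i => [[]//|d] i _ A mA; apply: sub_sigma_algebra.
rewrite -bigcup_mkord_ord; exists i; first exact: ltn_ord.
by exists A => //; rewrite inord_val.
Qed.

Lemma measurable_fun_rV (R : realType) d d' (T : measurableType d')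
    (f : T -> 'rV[R]_d) :
  (forall i, measurable_fun [set: T] (rV_coord i \o f)) ->
  measurable_fun [set: T] f.
Proof.
move=> mf _ A mA.
have : g_sigma_preimage (fun i => rV_coord i \o f) `<=` measurable.
  apply: smallest_sub; first exact: sigma_algebra_measurable.
  case: d f mf {A mA} => [|d] f mf; first by rewrite big_ord0.
  rewrite -bigcup_mkord_ord; apply: bigcup_sub => i Ii.
  by move=> B [C mC <-]; exact: mf.
by apply; rewrite g_sigma_preimage_comp; exists A.
Qed.

(* Lebesgue measure on R^d, by induction on d: the image of the product of
   the Lebesgue measures on R and R^d under (a, x) |-> (a, x_1, ..., x_d). *)
Section lebesgue_rV.
Context {R : realType}.

Definition cons_rV d (p : measurableTypeR R * 'rV[R]_d) : 'rV[R]_d.+1 :=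
  \row_i oapp (fun j => p.2 0 j) (p.1 : R) (unlift ord0 i).

Lemma measurable_cons_rV d : measurable_fun setT (@cons_rV d).
Proof.
apply: measurable_fun_rV => i.
case: (unliftP ord0 i) => [j ->|->].
  rewrite (_ : _ \o _ = rV_coord j \o snd); last first.
    by apply/funext => p /=; rewrite /rV_coord mxE liftK.
  by apply: measurableT_comp => //; exact: measurable_rV_coord.
rewrite (_ : _ \o _ = fst); first exact: measurable_fst.
by apply/funext => p /=; rewrite /rV_coord mxE unlift_none.
Qed.

Definition uncons_rV d (x : 'rV[R]_d.+1) : measurableTypeR R * 'rV[R]_d :=
  (x 0 ord0, \row_j x 0 (lift ord0 j)).

Lemma cons_rVK d : cancel (@cons_rV d) (@uncons_rV d).
Proof.
case=> a x; rewrite /uncons_rV mxE unlift_none /=; congr (_, _).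
by apply/rowP => j; rewrite !mxE liftK.
Qed.

Lemma measurable_uncons_rV d : measurable_fun setT (@uncons_rV d).
Proof.
apply/measurable_fun_pairP; split => /=.
  exact: (measurable_rV_coord ord0).
apply: measurable_fun_rV => i.
rewrite (_ : _ \o _ = rV_coord (lift ord0 i)).
  exact: measurable_rV_coord.
by apply/funext => x /=; rewrite /rV_coord mxE.
Qed.

Section lebesgue_cons.
Context d (mu : {sigma_finite_measure set 'rV[R]_d -> \bar R}).

Definition lebesgue_cons : set 'rV[R]_d.+1 -> \bar R :=
  pushforward (lebesgue_measure \x mu)%E (@cons_rV d).

Let lebesgue_cons0 : lebesgue_cons set0 = 0%E.
Proof. by rewrite /lebesgue_cons /pushforward preimage_set0 measure0. Qed.

Let lebesgue_cons_ge0 A : (0 <= lebesgue_cons A)%E.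
Proof. by rewrite /lebesgue_cons /pushforward; apply: measure_ge0. Qed.

Let lebesgue_cons_sigma_additive : semi_sigma_additive lebesgue_cons.
Proof.
move=> F mF tF mUF; rewrite /lebesgue_cons /pushforward preimage_bigcup.
apply: measure_semi_sigma_additive.
- by move=> n; rewrite -[X in measurable X]setTI; exact: measurable_cons_rV.
- apply/trivIsetP => /= i j _ _ ij; rewrite -preimage_setI.
  by move/trivIsetP : tF => /(_ _ _ _ _ ij) ->//; rewrite preimage_set0.
- by rewrite -preimage_bigcup -[X in measurable X]setTI;
    exact: measurable_cons_rV.
Qed.

HB.instance Definition _ := isMeasure.Build _ _ _ lebesgue_cons
  lebesgue_cons0 lebesgue_cons_ge0 lebesgue_cons_sigma_additive.

Let lebesgue_cons_sigma_finite : sigma_finite setT lebesgue_cons.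
Proof.
have /sigma_finiteP[F [TF ndF Foo]] := sigma_finiteT (@lebesgue_measure R).
have /sigma_finiteP[G [TG ndG Goo]] := sigma_finiteT mu.
exists (fun n => @uncons_rV d @^-1` (F n `*` G n)).
  rewrite -preimage_bigcup -[LHS](preimage_setT (@uncons_rV d)).
  congr (_ @^-1` _); rewrite -setXTT TF TG predeqE => -[x y]; split.
    move=> [/= [n _ Fnx] [k _ Gky]]; exists (maxn n k) => //; split.
    - by move: x Fnx; exact/subsetPset/ndF/leq_maxl.
    - by move: y Gky; exact/subsetPset/ndG/leq_maxr.
  by move=> [n _ []/= ? ?]; split; exists n.
move=> n; have [mF Fnoo] := Foo n; have [mG Gnoo] := Goo n; split.
  by rewrite -[X in measurable X]setTI;
    apply: measurable_uncons_rV => //; exact: measurableX.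
rewrite /lebesgue_cons /pushforward -comp_preimage.
rewrite (_ : _ \o _ = idfun); last by apply/funext => x /=; rewrite cons_rVK.
rewrite preimage_id.
by rewrite product_measure1E// lte_mul_pinfty// ge0_fin_numE.
Qed.

HB.instance Definition _ := Measure_isSigmaFinite.Build _ _ _ lebesgue_cons
  lebesgue_cons_sigma_finite.

End lebesgue_cons.

Fixpoint lebesgue_rV d : {sigma_finite_measure set 'rV[R]_d -> \bar R} :=
  match d with
  | 0 => dirac (0 : 'rV[R]_0)
  | d'.+1 => lebesgue_cons (lebesgue_rV d')
  end.

Lemma lebesgue_rV_box d (A : 'I_d -> set (measurableTypeR R)) :
  (forall i, measurable (A i)) ->
  lebesgue_rV d [set x | forall i, A i (x 0 i)] =
  (\prod_(i < d) lebesgue_measure (A i))%E.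
Proof.
elim: d A => [|d IH] A mA /=.
  rewrite big_ord0 diracE mem_set//= => -[].
  by [].
rewrite big_ord_recl.
pose B := [set x : 'rV[R]_d | forall i, A (lift ord0 i) (x 0 i)].
transitivity ((lebesgue_measure \x lebesgue_rV d)%E (A ord0 `*` B)).
  congr ((lebesgue_measure \x lebesgue_rV d)%E _).
  apply/seteqP; split => -[a x] /= H; last first.
    case: H => Ha Hx i; rewrite mxE.
    by case: (unliftP ord0 i) => [j ->|->] //=.
  split; first by have := H ord0; rewrite mxE unlift_none.
  by move=> i; have := H (lift ord0 i); rewrite mxE liftK.
rewrite product_measure1E//; first by rewrite (IH (fun i => A (lift ord0 i))).
rewrite /B (_ : [set _ | _] =
    \bigcap_(i in [set: 'I_d]) (rV_coord i @^-1` A (lift ord0 i))); last first.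
  by apply/seteqP; split => x H i => [_|]; exact: H.
apply: fin_bigcap_measurable => // i _; rewrite -[X in measurable X]setTI.
exact: (@measurable_rV_coord R d i measurableT _ (mA (lift ord0 i))).
Qed.

End lebesgue_rV.

Section L2.
Context {disp : measure_display} {X : measurableType disp} {R : realType}.
Variables (mu : {measure set X -> \bar R}) (D : set X).

Definition L2norm (f : X -> R) : \bar R := ('N[mu]_(2%:E)[(EFin \o f) \_ D])%E.

Definition L2 (f : X -> R) : Prop :=
  measurable_fun D f /\ (L2norm f < +oo)%E.

Definition L2ip (f g : X -> R) : R := \int[mu]_(x in D) (f x * g x).

Variable d : nat.
Implicit Types F G : X -> 'rV[R]_d.

Definition L2v F : Prop := forall i, L2 (fun x => F x 0 i).

Definition L2vnorm2 F : \bar R :=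
  (\sum_(i < d) L2norm (fun x => F x 0%R i) ^+ 2)%E.

Definition L2vip F G : R :=
  \sum_(i < d) L2ip (fun x => F x 0 i) (fun x => G x 0 i).

End L2.

Section sobolev.
Context {R : realType} (d : nat).
Local Notation X := 'rV[R]_d.
Implicit Types (Omega : set X) (v phi : X -> R) (g : X -> 'rV[R]_d).

Definition partial (i : 'I_d) phi : X -> R := 'D_(delta_mx 0 i) phi.

Definition gradient phi : X -> 'rV[R]_d := fun x => \row_i partial i phi x.

Definition smooth phi : Prop := forall s : seq 'I_d,
  continuous (foldr partial phi s) /\
  forall i x, derivable (foldr partial phi s) x (delta_mx 0 i).

Definition test_function Omega phi : Prop :=
  let supp := closure [set x | phi x != 0] in
  [/\ smooth phi, compact supp & supp `<=` Omega].

Local Notation mu := (lebesgue_rV d).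

Definition weak_gradient Omega v g : Prop :=
  forall phi, test_function Omega phi -> forall i,
    L2ip mu Omega v (partial i phi) = - L2ip mu Omega (fun x => g x 0 i) phi.

Definition H1_with Omega v g : Prop :=
  [/\ L2 mu Omega v, L2v mu Omega g & weak_gradient Omega v g].

(* [H10_with Omega v g]: v is in the H^1-closure of the test functions, with
   weak gradient g. *)
Definition H10_with Omega v g : Prop :=
  H1_with Omega v g /\
  forall e : R, 0 < e -> exists2 phi, test_function Omega phi &
    (L2norm mu Omega (v \- phi)%R ^+ 2
     + L2vnorm2 mu Omega (g \- gradient phi)%R < e%:E)%E.

Definition H10 Omega v : Prop := exists g, H10_with Omega v g.

End sobolev.

Section space_time.
Context {R : realType} (d : nat).
Local Notation X := 'rV[R]_d.
Local Notation XT := ('rV[R]_d * measurableTypeR R)%type.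
Variables (Omega : set X) (T : R).

Definition st_measure : {measure set XT -> \bar R} :=
  (lebesgue_rV d \x lebesgue_measure)%E.

Definition slab (a b : R) : set XT := Omega `*` `]a, b[.

Definition slice {Y} (u : XT -> Y) (t : R) : X -> Y := fun x => u (x, t).

(* L^2(0,T;H^1_0(Omega)), as jointly measurable functions on Q_T; the second
   argument is the spatial gradient. *)
Definition L2H10_with (u : XT -> R) (G : XT -> 'rV[R]_d) : Prop :=
  [/\ L2 st_measure (slab 0 T) u, L2v st_measure (slab 0 T) G &
      {ae lebesgue_measure, forall t : R,
        0 < t < T -> H10_with Omega (slice u t) (slice G t)}].

Definition L2H10 u : Prop := exists G, L2H10_with u G.

(* The spatial gradient on Q_T of u in L^2(0,T;H^1_0(Omega)); it is determined
   almost everywhere, and only ever integrated over Q_T. *)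
Definition gradx (u : XT -> R) : XT -> 'rV[R]_d :=
  xget (fun=> 0) [set G | L2H10_with u G].

(* The norm of L^r(0,T;L^2(Omega)). *)
Definition LrL2norm (r : \bar R) (u : XT -> R) : \bar R :=
  ('N[lebesgue_measure]_r[
     (fun t => L2norm (lebesgue_rV d) Omega (slice u t)) \_ `]0%R, T[])%E.

Definition dt (u : XT -> R) : XT -> R :=
  fun z => derive1 (fun s : R => u (z.1, s)) z.2.

Definition trace_right (u : XT -> R) (t : R) : X -> R :=
  fun x => lim (u (x, s) @[s --> t^'+]).

Definition trace_left (u : XT -> R) (t : R) : X -> R :=
  fun x => lim (u (x, s) @[s --> t^'-]).

Definition jump (u : XT -> R) (t : R) : X -> R :=
  trace_right u t \- trace_left u t.

End space_time.

Section mesh.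
Context {R : realType} (d : nat).
Local Notation X := 'rV[R]_d.

(* A d-simplex is represented by the matrix whose d+1 rows are its vertices. *)
Local Notation simplex := 'M[R]_(d.+1, d).
Implicit Types (Omega : set X) (K : simplex) (Th : seq simplex).

(* The convex hull of the vertices with index in S. *)
Definition face K (S : {set 'I_d.+1}) : set X :=
  [set x | exists l : 'I_d.+1 -> R,
    [/\ forall i, 0 <= l i, forall i, i \notin S -> l i = 0,
        \sum_i l i = 1 & x = \sum_i l i *: row i K]].

Definition hull K : set X := face K [set: 'I_d.+1].

Definition nondegenerate K : Prop :=
  row_free (\matrix_(i < d) (row (lift ord0 i) K - row ord0 K)).

Definition polytopic_domain Omega : Prop :=
  [/\ Omega !=set0, connected Omega, Omega = (closure Omega)° &
      exists s : seq simplex, closure Omega = \bigcup_(K in [set` s]) hull K].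

(* Two distinct elements meet in a common proper face, possibly empty. *)
Definition conforming_mesh Omega Th : Prop :=
  [/\ forall K, K \in Th -> nondegenerate K,
      closure Omega = \bigcup_(K in [set` Th]) hull K &
      forall K K', K \in Th -> K' \in Th -> K != K' ->
        exists S S' : {set 'I_d.+1},
          [/\ S != [set: 'I_d.+1]%SET, hull K `&` hull K' = face K S &
              hull K `&` hull K' = face K' S']].

Definition edist (x y : X) : R := Num.sqrt (\sum_i (x 0 i - y 0 i) ^+ 2).

Definition diameter K : R :=
  sup [set r | exists x y, [/\ hull K x, hull K y & r = edist x y]].

(* The diameter of the largest ball contained in K. *)
Definition inball_diameter K : R :=
  sup [set r | 0 <= r /\ exists c, [set y | edist c y <= r / 2] `<=` hull K].

Definition shape_regular (gamma : R) Th : Prop :=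
  forall K, K \in Th -> diameter K <= gamma * inball_diameter K.

(* Total degree at most p. *)
Definition poly_deg (p : nat) (P : X -> R) : Prop :=
  exists c : {ffun 'I_d -> 'I_p.+1} -> R, forall x,
    P x = \sum_(a : {ffun 'I_d -> 'I_p.+1} | (\sum_i a i <= p)%N)
            c a * \prod_i x 0 i ^+ a i.

Definition Vh Omega Th (p : nat) (v : X -> R) : Prop :=
  H10 Omega v /\
  forall K, K \in Th -> exists2 P, poly_deg p P &
    {ae lebesgue_rV d, forall x, hull K x -> v x = P x}.

End mesh.

Section discretization.
Context {R : realType} (d : nat).
Local Notation X := 'rV[R]_d.
Local Notation XT := ('rV[R]_d * measurableTypeR R)%type.
Variables (Omega : set X) (T : R) (N : nat) (t : nat -> R).
Local Notation mu := (lebesgue_rV d).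
Local Notation muT := (@st_measure R d).

Definition time_partition : Prop :=
  [/\ t 0%N = 0, t N = T & forall n, (n < N)%N -> t n < t n.+1].

(* The values of u at the nodes t_n are irrelevant; measurability on Q_T
   excludes pathological ones. *)
Definition Vht (Th : seq 'M[R]_(d.+1, d)) (p q : nat) (u : XT -> R) : Prop :=
  measurable_fun (slab Omega 0 T) u /\
  forall n, (n < N)%N -> exists2 w : 'I_q.+1 -> X -> R,
    forall j, Vh Omega Th p (w j) &
    forall x s, Omega x -> t n < s < t n.+1 ->
      u (x, s) = \sum_(j < q.+1) s ^+ j * w j x.

Definition Bht (nu : R) (u v : XT -> R) : R :=
  \sum_(0 <= n < N) L2ip muT (slab Omega (t n) (t n.+1)) (dt u) v
  + \sum_(1 <= n < N) L2ip mu Omega (jump u (t n)) (trace_right v (t n))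
  + L2ip mu Omega (trace_right u 0) (trace_right v 0)
  + nu * L2vip muT (slab Omega 0 T) (gradx Omega T u) (gradx Omega T v).

(* The square of the jump seminorm. *)
Definition jump_seminorm2 (u : XT -> R) : \bar R :=
  (L2norm mu Omega (trace_left u T) ^+ 2
   + \sum_(1 <= n < N) L2norm mu Omega (jump u (t n)) ^+ 2
   + L2norm mu Omega (trace_right u 0%R) ^+ 2)%E.

End discretization.

(* Main.v *)
(* On the n-th time slab write [u = \sum_j sigma^j w_j], where [sigma] is time
   rescaled to [0, 1], and let [a] be the incoming trace ([u0] if [n = 0]).
   Testing with [u] itself gives the energy identity, in which the term in [f]
   is at most a constant times [F_n m_n], with [F_n] the norm of [f] in
   L^1(I_n; L^2) and [m_n^2] the time average of [||u||^2] over the slab.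
   Let [D] be the Gram matrix of [\int_0^1 p' r + p(0) r(0)] and [H] the
   Hilbert matrix. Since [D] is invertible there is [L] with [D L = H]; testing
   with the function of coefficients [L w] turns the time-derivative and
   jump terms into [m_n^2 - (a, (L w)_0)], hence
   [m_n^2 <= C ((||a|| + F_n) m_n + gradient terms)].
   All norms on polynomials of degree at most [q] on [0, 1] are equivalent, so
   the constants depend only on [q], and [m_n] controls [||u(t)||] on the
   whole slab. Summing the energy identities and using the second estimate at
   the slab where [m_n] is largest closes the argument with Young's inequality.
   A function has at most one L^2(0, T; H^1_0) gradient: the difference of two
   candidates is orthogonal to all test functions, and it is an L^2 limit of
   differences of derivatives of test functions. *)
Require Import Defs.
From mathcomp Require Import all_boot all_order all_algebra.
From mathcomp Require Import all_classical all_reals all_analysis.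
From mathcomp Require Import measurable_realfun ess_sup_inf polyrcf ring lra.

Set Implicit Arguments.
Unset Strict Implicit.
Unset Printing Implicit Defensive.

Import Order.TTheory GRing.Theory Num.Theory.
Import numFieldNormedType.Exports.

Local Open Scope classical_set_scope.
Local Open Scope ring_scope.

(** * Gram matrices of polynomials on [0, 1] *)

Section hilbert_form.
Context {R : realType} (q : nat).
Implicit Types (A : 'M[R]_q.+1) (c : 'I_q.+1 -> R).

(** The norm of [f] is L^1 in time, so its contribution has to be matched with a supremum in time of
    the solution, while the energy identity by itself bounds the solution only at the nodes. Cutting
    the solution off in time inside a slab would leave the discrete space, hence the second test
    function. The matrix [L] acts on the time coefficients alone and so commutes with the spatial
    gradient: the viscous term of the lifted function stays comparable with the one that the energy
    estimate already controls. In rescaled time the step length cancels from the time derivative, so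
    no relation between the steps is needed. The lifted estimate is used at one slab and never
    summed, and the loads are summed against the largest [m n]; this is why neither [N] nor [T]
    enters the constant. Since [gradx] is chosen and not computed, uniqueness of the gradient is
    what allows the scheme to be evaluated on concrete test functions. *)

Definition quadf A c : R := \sum_j \sum_k A j k * (c j * c k).

Definition hilbert_mx : 'M[R]_q.+1 := \matrix_(j, k) (j + k).+1%:R^-1.

(* The Gram matrix of [\int_0^1 p' r + p(0) r(0)] in the monomial basis. *)
Definition dg_mx : 'M[R]_q.+1 :=
  \matrix_(j, k) if j == 0%N :> nat then (k == 0%N :> nat)%:R
                 else j%:R / (j + k)%:R.

Lemma hilbert_form_gt0 c j : c j != 0 -> 0 < quadf hilbert_mx c.
Proof.
move=> cj.
pose p : {poly R} := \sum_(k < q.+1) (c k)%:P * 'X^k.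
have pE k : p`_(nat_of_ord k) = c k.
  rewrite coef_sum (bigD1 k)//= coefCM coefXn eqxx mulr1 big1 ?addr0// => i ik.
  rewrite coefCM coefXn.
  by rewrite (_ : (k == i :> nat) = false) ?mulr0// eq_sym; exact/negbTE.
have p0 : p != 0 by apply/eqP => p0; move: cj; rewrite -pE p0 coef0 eqxx.
pose P : {poly R} :=
  \sum_(i < q.+1) \sum_(k < q.+1) ((i + k).+1%:R^-1 * (c i * c k))%:P * 'X ^+ (i + k).+1.
have natK (x : R) n : (n.+1%:R^-1 * x) *+ n.+1 = x.
  by rewrite -[LHS]mulr_natl mulrA divff ?mul1r// pnatr_eq0.
have P'E : P^`() = p ^+ 2.
  rewrite expr2 /P /p raddf_sum mulr_suml; apply: eq_bigr => i _.
  rewrite [LHS](raddf_sum (@deriv R)) mulr_sumr; apply: eq_bigr => k _ /=.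
  rewrite mul_polyC derivZ derivXn /= -scalerMnr scalerMnl natK exprD -mul_polyC polyCM.
  by rewrite mulrACA.
have P0 : P.[0] = 0.
  rewrite horner_sum big1// => i _; rewrite horner_sum big1// => k _.
  by rewrite hornerCM hornerXn expr0n mulr0.
have P1 : P.[1] = quadf hilbert_mx c.
  rewrite horner_sum; apply: eq_bigr => i _; rewrite horner_sum.
  by apply: eq_bigr => k _; rewrite hornerCM hornerXn expr1n mulr1 mxE.
(* [p] has no root strictly between [0] and [e], so [P] increases strictly up to [e]; beyond [e],
   monotonicity is enough. *)
pose e := next_root p 0 1.
have e0 : 0 < e by apply: next_root_gt.
have e1 : e <= 1.
  have := next_root_in p 0 1; rewrite in_itv /= => /andP[_].
  by rewrite (max_l ler01).
have PePos : P.[0] < P.[e].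
  apply: (@derpr R P 0 e); last by rewrite in_itv /= e0 lexx.
  move=> x xe; rewrite P'E hornerE exprn_even_gt0//=.
  by have := next_noroot xe; rewrite /root.
rewrite -P1 (lt_le_trans _ (_ : P.[e] <= _))//; first by rewrite -P0.
apply: (@ler_hornerW R 0 1) => //.
- by move=> x _; rewrite P'E hornerE sqr_ge0.
- by rewrite in_itv /= (ltW e0).
- by rewrite in_itv /= lexx ler01.
Qed.

Lemma hilbert_form_ge0 c : 0 <= quadf hilbert_mx c.
Proof.
case: (pselect (exists j, c j != 0)) => [[j /hilbert_form_gt0/ltW//]|nc].
rewrite /quadf big1// => j _; rewrite big1// => k _.
suff -> : c j = 0 by rewrite mul0r mulr0.
by apply/eqP/negPn/negP => cj; apply: nc; exists j.
Qed.

Lemma quadf_mx A (c : 'rV[R]_q.+1) : quadf A (c 0) = (c *m A *m c^T) 0 0.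
Proof.
rewrite mxE /quadf exchange_big; apply: eq_bigr => k _.
by rewrite !mxE mulr_suml; apply: eq_bigr => j _; rewrite mulrCA mulrA.
Qed.

Lemma hilbert_mx_unit : hilbert_mx \in unitmx.
Proof.
rewrite -row_free_unit; apply: inj_row_free => v v0.
apply/rowP => j; rewrite mxE; apply/eqP/negPn/negP => /hilbert_form_gt0.
by rewrite quadf_mx v0 mul0mx mxE ltxx.
Qed.

(** Equivalence of norms with an explicit constant instead of compactness. Each entry of [v *m H]
    pairs [v] with a monomial whose form is at most 1, hence is at most the square root of the form;
    multiplying by the inverse matrix recovers the coefficients. *)
Lemma hilbert_form_coef : exists2 K : R, 0 <= K &
  forall c j, c j ^+ 2 <= K * quadf hilbert_mx c.
Proof.
pose H := hilbert_mx.
pose S := \sum_i \sum_j `|invmx H i j|.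
exists (S ^+ 2); first exact: sqr_ge0.
move=> c j; set Q := quadf _ c.
have Q0 : 0 <= Q := hilbert_form_ge0 c.
pose v : 'rV[R]_q.+1 := \row_k c k.
have QE : Q = quadf H (v 0).
  by apply: eq_bigr => i _; apply: eq_bigr => k _; rewrite !mxE.
(* Cauchy-Schwarz for the form, against the monomial of degree [k] *)
have Hv k : `|(v *m H) 0 k| <= Num.sqrt Q.
  rewrite -(@ler_pXn2r _ 2)// ?nnegrE ?sqrtr_ge0// sqr_sqrtr//.
  rewrite real_normK ?num_real//; set m := (v *m H) 0 k.
  pose hk : R := H k k.
  have hk0 : 0 < hk by rewrite /hk mxE invr_gt0 ltr0n.
  have hk1 : hk <= 1 by rewrite /hk mxE invf_le1 ?ltr0n// ler1n.
  have HT : H^T = H by apply/matrixP => a b; rewrite !mxE addnC.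
  pose e : 'rV[R]_q.+1 := delta_mx 0 k.
  pose y := v - (m / hk) *: e.
  have := hilbert_form_ge0 (y 0); rewrite quadf_mx -/H.
  have -> : (y *m H *m y^T) 0 0 = Q - m ^+ 2 / hk.
    have mE : (v *m H *m e^T) 0 0 = m.
      by rewrite /e trmx_delta -colE mxE.
    have mE' : (e *m H *m v^T) 0 0 = m.
      rewrite -mE -[in LHS](trmxK (e *m H *m v^T)) [in LHS]mxE.
      by rewrite !trmx_mul trmxK HT mulmxA.
    have eE : (e *m H *m e^T) 0 0 = hk by rewrite /e trmx_delta -colE -rowE /hk !mxE.
    have aE : (v *m H *m v^T) 0 0 = Q by rewrite QE quadf_mx.
    have -> : y *m H *m y^T = v *m H *m v^T - (m / hk) *: (v *m H *m e^T)
        - ((m / hk) *: (e *m H *m v^T) - (m / hk) *: ((m / hk) *: (e *m H *m e^T))).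
      have -> : y^T = v^T - (m / hk) *: e^T by rewrite /y linearB linearZ.
      by rewrite /y !mulmxBl !mulmxBr -!(scalemxAl, scalemxAr).
    have gen (X Y Z W : 'M[R]_1) (r : R) :
        (X - r *: Z - (r *: Y - r *: (r *: W))) 0 0 =
        X 0 0 - r * Y 0 0 - r * Z 0 0 + r * (r * W 0 0).
      by rewrite !mxE; ring.
    rewrite gen aE mE mE' eE; field; by rewrite gt_eqF.
  rewrite subr_ge0 => /(le_trans _); apply.
  by rewrite ler_pdivlMr// ler_piMr// sqr_ge0.
have cj : `|c j| <= S * Num.sqrt Q.
  have -> : c j = ((v *m H) *m invmx H) 0 j by rewrite mulmxK ?hilbert_mx_unit// mxE.
  rewrite mxE (le_trans (ler_norm_sum _ _ _))// /S mulr_suml ler_sum// => i _.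
  rewrite normrM mulrC ler_pM//.
  by rewrite (bigD1 j)//= ler_wpDr// sumr_ge0.
have S0 : 0 <= S by apply: sumr_ge0 => i _; apply: sumr_ge0.
rewrite -[Q]sqr_sqrtr// -exprMn -[c j ^+ 2]real_normK ?num_real//.
by rewrite ler_pXn2r ?nnegrE// mulr_ge0 ?sqrtr_ge0.
Qed.

(** Integration by parts: $j/(j+k) + k/(j+k) = 1$, so the symmetric part of [dg_mx] is half the
    all-ones matrix plus half the corner entry. The right-hand side is $p(1)^2 + p(0)^2$. *)
Lemma dg_form c : 2 * quadf dg_mx c = (\sum_j c j) ^+ 2 + c ord0 ^+ 2.
Proof.
have -> : 2 * quadf dg_mx c = \sum_j \sum_k (dg_mx j k + dg_mx k j) * (c j * c k).
  rewrite mulr_natl mulr2n {2}/quadf exchange_big -big_split /=.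
  apply: eq_bigr => j _; rewrite -big_split/=; apply: eq_bigr => k _.
  by rewrite mulrDl (mulrC (c k)).
have E j k : dg_mx j k + dg_mx k j = 1 + ((j == ord0) && (k == ord0))%:R.
  rewrite !mxE -!val_eqE /=.
  case: (eqVneq (nat_of_ord j) 0%N) => [->|j0];
    case: (eqVneq (nat_of_ord k) 0%N) => [k0|k0] //=; rewrite ?k0.
  - by rewrite addn0 divff ?pnatr_eq0// add0r addr0.
  - by rewrite addn0 divff ?pnatr_eq0// addr0.
  - by rewrite [(k + j)%N]addnC -mulrDl -natrD divff ?addr0// pnatr_eq0 addn_eq0 negb_and j0.
under eq_bigr do under eq_bigr do rewrite E mulrDl mul1r.
under eq_bigr do rewrite big_split/=.
rewrite big_split/= expr2 mulr_suml; congr (_ + _).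
  by apply: eq_bigr => j _; rewrite mulr_sumr.
rewrite (bigD1 ord0)//= [X in _ + X]big1 ?addr0; last first.
  by move=> j j0; rewrite big1// => k _; rewrite (negbTE j0) mul0r.
rewrite (bigD1 ord0)//= [X in _ + X]big1 ?addr0 ?mul1r ?expr2//.
by move=> j j0; rewrite (negbTE j0) mul0r.
Qed.

(** If [p] is in the kernel, [dg_form] gives $p(0) = 0$; what remains says that $p'$ is orthogonal
    to all polynomials of degree at most [q], so $p' = 0$ as the Hilbert matrix is invertible. *)
Lemma dg_mx_unit : dg_mx \in unitmx.
Proof.
rewrite -row_free_unit; apply: inj_row_free => v v0.
have q0 : 2 * quadf dg_mx (v 0) = 0 by rewrite quadf_mx v0 mul0mx mxE mulr0.
have v00 : v 0 ord0 = 0.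
  move: q0; rewrite dg_form => /eqP.
  by rewrite paddr_eq0 ?sqr_ge0// => /andP[_]; rewrite sqrf_eq0 => /eqP.
(* The coefficients of $p'$, padded by a zero in degree [q]. *)
pose w : 'rV[R]_q.+1 := \row_j if (j < q)%N then j.+1%:R * v 0 (inord j.+1) else 0.
have wH : w *m hilbert_mx = 0.
  rewrite -v0; apply/rowP => k; rewrite !mxE big_ord_recr [RHS]big_ord_recl /=.
  rewrite v00 mul0r add0r !mxE ltnn mul0r addr0; apply: eq_bigr => i _.
  rewrite !mxE /= ltn_ord mulrAC [RHS]mulrC; congr (_ / _ * v _ _).
  by apply/val_inj; rewrite /= inordK // ltnS.
have w0 : w = 0 by rewrite -[w](mulmxK hilbert_mx_unit) wH mul0mx.
apply/rowP => j; rewrite mxE.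
have [->//|[j' jj']] : j = ord0 \/ exists j', j = j'.+1 :> nat.
  by case: j => -[|j'] jq; [left; exact/val_inj|right; exists j'].
have j'q : (j' < q)%N by rewrite -ltnS -jj' ltn_ord.
have /rowP/(_ (inord j')) := w0; rewrite !mxE inordK ?j'q; last exact: ltnW.
move/eqP; rewrite mulf_eq0 pnatr_eq0 /= => /eqP <-; congr (v _ _).
by apply/val_inj; rewrite /= inordK.
Qed.

(** On coefficients, [L] sends $r$ to the $z$ with $\int_0^1 p' z + p(0) z(0) = \int_0^1 p r$ for
    all $p$ of degree at most [q]: the Galerkin solution of the backward problem $-z' = r$, $z(1) =
    0$. *)
Lemma dg_lift : exists L : 'M[R]_q.+1, dg_mx *m L = hilbert_mx.
Proof. by exists (invmx dg_mx *m hilbert_mx); rewrite mulKVmx// dg_mx_unit. Qed.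

End hilbert_form.

(** * Square-integrable functions *)

Section L2_theory.
Context {disp : measure_display} {X : measurableType disp} {R : realType}.
Variables (mu : {measure set X -> \bar R}) (D : set X).
Implicit Types f g : X -> R.

Lemma L2normE f : L2norm mu D f = sqrte (\int[mu]_(x in D) (f x ^+ 2)%:E)%E.
Proof.
rewrite /L2norm unlock poweR12_sqrt; last first.
  by apply: integral_ge0 => x _; exact: poweR_ge0.
congr sqrte; rewrite [RHS]integral_mkcond; apply: eq_integral => x _.
rewrite !patchE; case: ifPn => _ /=; last by rewrite normr0 powR0.
by rewrite powR_mulrn// real_normK ?num_real.
Qed.

Lemma L2norm_sqr f : (L2norm mu D f ^+ 2 = \int[mu]_(x in D) (f x ^+ 2)%:E)%E.
Proof.
by rewrite L2normE sqr_sqrte//; apply: integral_ge0 => x _; rewrite lee_fin sqr_ge0.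
Qed.

Lemma eq_L2norm f g : (forall x, D x -> f x = g x) -> L2norm mu D f = L2norm mu D g.
Proof.
move=> fg; rewrite !L2normE; congr sqrte; apply: eq_integral => x /set_mem Dx.
by rewrite fg.
Qed.

Lemma eq_L2 f g : (forall x, D x -> f x = g x) -> L2 mu D f -> L2 mu D g.
Proof.
move=> fg [mf lf]; split; last by rewrite -(eq_L2norm fg).
by apply: eq_measurable_fun mf => x /set_mem Dx; rewrite fg.
Qed.

Lemma L2ipE f g : L2ip mu D f g = \int[mu]_(x in D) (f x * g x).
Proof. by []. Qed.

Lemma eq_L2ip f f' g g' : (forall x, D x -> f x = f' x) ->
  (forall x, D x -> g x = g' x) -> L2ip mu D f g = L2ip mu D f' g'.
Proof.
move=> ff gg; apply: eq_Rintegral => x /set_mem Dx.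
by rewrite ff ?gg.
Qed.

Hypothesis mD : measurable D.

Lemma L2P f : L2 mu D f <->
  measurable_fun D f /\ mu.-integrable D (EFin \o (fun x => f x ^+ 2)).
Proof.
have i0 : (0 <= \int[mu]_(x in D) (f x ^+ 2)%:E)%E.
  by apply: integral_ge0 => x _; rewrite lee_fin sqr_ge0.
have iE : (\int[mu]_(x in D) `|(f x ^+ 2)%:E| = \int[mu]_(x in D) (f x ^+ 2)%:E)%E.
  by apply: eq_integral => x _; rewrite /= ger0_norm ?sqr_ge0.
split=> -[mf].
  rewrite L2normE => lf; split=> //; apply/integrableP; split.
    by apply/measurable_EFinP; exact: measurable_funX.
  by rewrite /= iE; move: lf i0; case: (integral _ _ _) => //= r _ _; rewrite ltry.
move=> /integrableP[_]; rewrite /= iE => lf; split=> //.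
by rewrite L2normE; move: lf; case: (integral _ _ _) => //= r _; rewrite ltry.
Qed.

Lemma L2_prod f g : L2 mu D f -> L2 mu D g ->
  mu.-integrable D (EFin \o (fun x => f x * g x)).
Proof.
move=> /L2P[mf If] /L2P[mg Ig].
apply: le_integrable (integrableD mD If Ig) => //.
  by apply/measurable_EFinP; exact: measurable_funM.
move=> x _ /=; rewrite lee_fin normrM [leRHS]ger0_norm ?addr_ge0 ?sqr_ge0//.
rewrite -(real_normK (num_real (f x))) -(real_normK (num_real (g x))).
have := sqr_ge0 (`|f x| - `|g x|); have := sqr_ge0 (`|f x| + `|g x|); nra.
Qed.

Lemma L2_0 : L2 mu D (fun=> 0).
Proof.
apply/L2P; split; first exact: measurable_cst.
apply: (@eq_integrable _ _ _ _ _ mD (cst 0%E)) => [x _ /=|]; first by rewrite expr0n.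
exact: integrable0.
Qed.

Lemma L2_D f g : L2 mu D f -> L2 mu D g -> L2 mu D (fun x => f x + g x).
Proof.
move=> Lf Lg; have [mf If] := (L2P _).1 Lf; have [mg Ig] := (L2P _).1 Lg.
apply/L2P; split; first exact: measurable_funD.
have If2 := integrableD mD (integrableD mD If (integrableZl mD 2 (L2_prod Lf Lg))) Ig.
apply: eq_integrable If2 => // x _ /=.
by rewrite -EFinM -!EFinD; congr EFin; ring.
Qed.

Lemma L2_Z (c : R) f : L2 mu D f -> L2 mu D (fun x => c * f x).
Proof.
move=> /L2P[mf If]; apply/L2P; split.
  by apply: measurable_funM => //; exact: measurable_cst.
apply: eq_integrable (integrableZl mD (c ^+ 2) If) => // x _ /=.
by rewrite -EFinM exprMn.
Qed.

Lemma L2_B f g : L2 mu D f -> L2 mu D g -> L2 mu D (fun x => f x - g x).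
Proof.
move=> Lf Lg; apply: eq_L2 (L2_D Lf (L2_Z (-1) Lg)) => x _.
by rewrite mulN1r.
Qed.

Lemma L2_sum (I : Type) (s : seq I) (P : pred I) (F : I -> X -> R) :
  (forall i, L2 mu D (F i)) -> L2 mu D (fun x => \sum_(i <- s | P i) F i x).
Proof.
move=> LF; elim: s => [|i s IH].
  by apply: eq_L2 L2_0 => x _; rewrite big_nil.
case: (boolP (P i)) => Pi; last by apply: eq_L2 IH => x _; rewrite big_cons (negbTE Pi).
by apply: eq_L2 (L2_D (LF i) IH) => x _; rewrite big_cons Pi.
Qed.

Lemma L2ipC f g : L2ip mu D f g = L2ip mu D g f.
Proof. by apply: eq_Rintegral => x _; rewrite mulrC. Qed.

Lemma L2ipDl f g h : L2 mu D f -> L2 mu D g -> L2 mu D h ->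
  L2ip mu D (fun x => f x + g x) h = L2ip mu D f h + L2ip mu D g h.
Proof.
move=> Lf Lg Lh; rewrite /L2ip -RintegralD//; try exact: L2_prod.
by apply: eq_Rintegral => x _; rewrite mulrDl.
Qed.

Lemma L2ipZl c f g : L2 mu D f -> L2 mu D g ->
  L2ip mu D (fun x => c * f x) g = c * L2ip mu D f g.
Proof.
move=> Lf Lg; rewrite /L2ip -RintegralZl//; try exact: L2_prod.
by apply: eq_Rintegral => x _; rewrite mulrA.
Qed.

Lemma L2ipBl f g h : L2 mu D f -> L2 mu D g -> L2 mu D h ->
  L2ip mu D (fun x => f x - g x) h = L2ip mu D f h - L2ip mu D g h.
Proof.
move=> Lf Lg Lh; rewrite /L2ip -RintegralB//; try exact: L2_prod.
by apply: eq_Rintegral => x _; rewrite mulrBl.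
Qed.

Lemma L2ipBr f g h : L2 mu D f -> L2 mu D g -> L2 mu D h ->
  L2ip mu D h (fun x => f x - g x) = L2ip mu D h f - L2ip mu D h g.
Proof. by move=> Lf Lg Lh; rewrite L2ipC L2ipBl// !(L2ipC h). Qed.

Lemma L2ip0l g : L2ip mu D (fun=> 0) g = 0.
Proof.
rewrite /L2ip; under eq_Rintegral do rewrite mul0r.
by rewrite Rintegral_cst// mul0r.
Qed.

Lemma L2ip0r g : L2ip mu D g (fun=> 0) = 0.
Proof. by rewrite L2ipC L2ip0l. Qed.

Lemma L2ip_suml (I : Type) (s : seq I) (P : pred I) (F : I -> X -> R) g :
  (forall i, L2 mu D (F i)) -> L2 mu D g ->
  L2ip mu D (fun x => \sum_(i <- s | P i) F i x) g =
  \sum_(i <- s | P i) L2ip mu D (F i) g.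
Proof.
move=> LF Lg; elim: s => [|i s IH].
  by rewrite big_nil -[RHS](L2ip0l g); apply: eq_L2ip => // x _; rewrite big_nil.
rewrite big_cons -IH; case: (boolP (P i)) => Pi.
  rewrite -L2ipDl//; last exact: L2_sum.
  by apply: eq_L2ip => // x _; rewrite big_cons Pi.
by apply: eq_L2ip => // x _; rewrite big_cons (negbTE Pi).
Qed.

Lemma L2ip_sumr (I : Type) (s : seq I) (P : pred I) (F : I -> X -> R) g :
  (forall i, L2 mu D (F i)) -> L2 mu D g ->
  L2ip mu D g (fun x => \sum_(i <- s | P i) F i x) =
  \sum_(i <- s | P i) L2ip mu D g (F i).
Proof.
move=> LF Lg; rewrite L2ipC L2ip_suml//; apply: eq_bigr => i _; exact: L2ipC.
Qed.

Lemma L2ip_ge0 f : 0 <= L2ip mu D f f.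
Proof. by apply: Rintegral_ge0 => x _; rewrite -expr2 sqr_ge0. Qed.

Lemma L2norm_ip f : L2 mu D f -> (L2norm mu D f ^+ 2 = (L2ip mu D f f)%:E)%E.
Proof.
move=> /L2P[mf If]; rewrite L2norm_sqr /L2ip /Rintegral.
rewrite (eq_integral (fun x => (f x * f x)%:E)) => [|x _]; last by rewrite -expr2.
rewrite fineK//; exact: integrable_fin_num.
Qed.

Lemma L2norm_sqrt f : L2 mu D f ->
  L2norm mu D f = (Num.sqrt (L2ip mu D f f))%:E.
Proof. by move=> Lf; rewrite L2normE -L2norm_sqr L2norm_ip. Qed.

Lemma L2ip_CS f g : L2 mu D f -> L2 mu D g ->
  L2ip mu D f g ^+ 2 <= L2ip mu D f f * L2ip mu D g g.
Proof.
move=> Lf Lg; set a := L2ip mu D f f; set b := L2ip mu D f g; set c := L2ip mu D g g.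
have H (r : R) : 0 <= a - 2 * r * b + r ^+ 2 * c.
  have := L2ip_ge0 (fun x => f x - r * g x).
  have Lrg := L2_Z r Lg; have Lfg := L2_B Lf Lrg.
  rewrite L2ipBl// !L2ipBr// !L2ipZl// [L2ip _ _ f (fun _ => r * _)]L2ipC.
  rewrite [L2ip _ _ g (fun _ => r * _)]L2ipC !L2ipZl// [L2ip _ _ g f]L2ipC.
  by rewrite -/a -/b -/c; congr (_ <= _); ring.
have a0 : 0 <= a := L2ip_ge0 f; have c0 : 0 <= c := L2ip_ge0 g.
have [c00|cn0] := eqVneq c 0.
  suff -> : b = 0 by rewrite expr0n mulr_ge0.
  (* With [c = 0] the expression in [H] is affine in [r], and this [r] gives it the value [-1]. *)
  apply/eqP/negPn/negP => b0; have := H ((a + 1) / (2 * b)).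
  rewrite c00 mulr0 addr0 (_ : 2 * _ * b = a + 1); first by lra.
  by field; rewrite b0.
have cp : 0 < c by rewrite lt_neqAle eq_sym cn0.
have := H (b / c).
rewrite (_ : _ + _ = (a * c - b ^+ 2) / c); last by field.
by rewrite pmulr_lge0 ?invr_gt0// subr_ge0.
Qed.

Lemma L2ip_le f g : L2 mu D f -> L2 mu D g ->
  L2ip mu D f g <= Num.sqrt (L2ip mu D f f) * Num.sqrt (L2ip mu D g g).
Proof.
move=> Lf Lg; rewrite -sqrtrM ?L2ip_ge0//.
by rewrite (le_trans (ler_norm _))// -sqrtr_sqr ler_wsqrtr// L2ip_CS.
Qed.

Lemma L2ip_young f g : L2 mu D f -> L2 mu D g ->
  L2ip mu D f g <= (L2ip mu D f f + L2ip mu D g g) / 2.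
Proof.
move=> Lf Lg; rewrite (le_trans (L2ip_le Lf Lg))//.
rewrite -{2}[L2ip mu D f f]sqr_sqrtr ?L2ip_ge0// -{2}[L2ip mu D g g]sqr_sqrtr ?L2ip_ge0//.
by have := sqr_ge0 (Num.sqrt (L2ip mu D f f) - Num.sqrt (L2ip mu D g g)); nra.
Qed.

(** By Cauchy-Schwarz, zero distance suffices to exchange two factors; almost-everywhere equality
    never has to be handled. *)
Lemma L2ip_null f f' g : L2 mu D f -> L2 mu D f' -> L2 mu D g ->
  L2ip mu D (fun x => f x - f' x) (fun x => f x - f' x) = 0 ->
  L2ip mu D f g = L2ip mu D f' g.
Proof.
move=> Lf Lf' Lg e0; apply/eqP; rewrite -subr_eq0 -L2ipBl// -sqrf_eq0 eq_le sqr_ge0.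
by rewrite andbT (le_trans (L2ip_CS (L2_B Lf Lf') Lg))// e0 mul0r.
Qed.

Definition L2form q (A : 'M[R]_q.+1) (w z : 'I_q.+1 -> X -> R) : R :=
  \sum_j \sum_k A j k * L2ip mu D (w j) (z k).

(** For fixed [x] the numbers [w j x] are the coefficients of a real polynomial in time, so every
    inequality between scalar forms integrates over [x] to one between forms of coefficient
    functions. *)
Lemma L2form_quadf q (A : 'M[R]_q.+1) (w : 'I_q.+1 -> X -> R) :
  (forall j, L2 mu D (w j)) ->
  mu.-integrable D (EFin \o (fun x => quadf A (fun j => w j x))) /\
  L2form A w w = \int[mu]_(x in D) quadf A (fun j => w j x).
Proof.
move=> Lw.
have Iw j k : mu.-integrable D (fun x => (A j k * (w j x * w k x))%:E).
  apply: eq_integrable (integrableZl mD (A j k) (L2_prod (Lw j) (Lw k))) => //.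
have E : (EFin \o (fun x => quadf A (fun j => w j x))) =
    (fun x => \sum_j \sum_k (A j k * (w j x * w k x))%:E)%E.
  apply/funext => x /=; rewrite /quadf -sumEFin; apply: eq_bigr => j _.
  by rewrite -sumEFin.
have Is j : mu.-integrable D (fun x => \sum_k (A j k * (w j x * w k x))%:E)%E.
  by apply: integrable_sum => // k _; exact: Iw.
split; first by rewrite E; apply: integrable_sum.
rewrite /Rintegral -[LHS]/(fine (L2form A w w)%:E); congr fine.
rewrite [RHS](_ : _ = \int[mu]_(x in D) (\sum_j \sum_k (A j k * (w j x * w k x))%:E))%E; last first.
  by rewrite -E.
rewrite integral_sum// /L2form -sumEFin; apply: eq_bigr => j _.
rewrite integral_sum// -sumEFin; apply: eq_bigr => k _.
rewrite EFinM /L2ip /Rintegral fineK; last by apply: integrable_fin_num => //; exact: L2_prod.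
by rewrite -integralZl//; exact: L2_prod.
Qed.

End L2_theory.

Lemma L2_subset disp (X : measurableType disp) (R : realType)
    (mu : {measure set X -> \bar R}) (D E : set X) (f : X -> R) :
  measurable D -> measurable E -> E `<=` D -> L2 mu D f -> L2 mu E f.
Proof.
move=> mD mE ED /L2P[mf If]; apply/L2P; split.
  exact: measurable_funS mf.
exact: integrableS If.
Qed.

(* Keeps unification from unfolding integrals. *)
Local Opaque L2ip L2norm.

(** * Test functions and H^1_0 *)

Section rV_topology.
Context {R : realType} (d : nat).
Local Notation X := 'rV[R]_d.
Local Notation mu := (lebesgue_rV d).

Lemma measurable_rV_box (A : 'I_d -> set (measurableTypeR R)) :
  (forall i, measurable (A i)) -> measurable [set x : X | forall i, A i (x 0 i)].
Proof.
move=> mA; rewrite (_ : [set _ | _] =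
    \bigcap_(i in [set: 'I_d]) (rV_coord i @^-1` A i)); last first.
  by apply/seteqP; split => x H i => [_|]; exact: H.
apply: fin_bigcap_measurable => // i _; rewrite -[X in measurable X]setTI.
exact: (@measurable_rV_coord R d i measurableT _ (mA i)).
Qed.

(** The sigma-algebra is generated by the coordinates. Balls of the maximum norm are boxes, so an
    open set is the union of the countably many boxes with rational corners that it contains. *)
Lemma open_rV_measurable (A : set X) : open A -> measurable A.
Proof.
move=> oA.
pose box (c : {ffun 'I_d -> rat * rat}) : set X :=
  [set x | forall i, `]ratr (c i).1, ratr (c i).2[%classic (x 0 i)].
have -> : A = \bigcup_c (if pselect (box c `<=` A) then box c else set0).
  apply/seteqP; split => [x Ax|x [c _]]; last first.
    by case: pselect => // cA /cA.
  have [e /= e0 xe] : exists2 e : R, 0 < e & ball x e `<=` A.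
    by move: oA; rewrite openE => /(_ _ Ax) /nbhs_ballP[e e0 xe]; exists e.
  have Hl i : exists r : rat, ratr r \in `](x 0 i - e), (x 0 i)[.
    by apply: rat_in_itvoo; rewrite gtrBl.
  have Hr i : exists r : rat, ratr r \in `](x 0 i), (x 0 i + e)[.
    by apply: rat_in_itvoo; rewrite ltrDl.
  have [l lP] := choice Hl; have [r rP] := choice Hr.
  exists [ffun i => (l i, r i)] => //; case: pselect => /= [_|[]].
    move=> i; rewrite ffunE /= in_itv /=.
    by have := lP i; have := rP i; rewrite !in_itv /= => /andP[-> _] /andP[_ ->].
  move=> y yc; apply: xe; split=> // i j; rewrite (ord1 i).
  have := yc j; rewrite ffunE /= in_itv /= => /andP[y1 y2].
  have := lP j; have := rP j; rewrite !in_itv /= => /andP[_ r2] /andP[l1 _].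
  by rewrite /ball /= ltr_norml; apply/andP; split; lra.
apply: countable_bigcupT_measurable => [|c]; first exact: countableP.
case: pselect => //= _.
apply: (measurable_rV_box
  (A := fun i => `]ratr (c i).1, ratr (c i).2[%classic)) => i.
exact: measurable_itv.
Qed.

Lemma continuous_rV_measurable (f : X -> R) : continuous f ->
  measurable_fun [set: X] f.
Proof.
move=> cf; apply: (measurability (@RGenOInfty.G R)).
  exact: RGenOInfty.measurableE.
move=> _ [_ [x ->] <-]; rewrite setTI; apply: open_rV_measurable.
by apply: open_comp => // y _; exact: cf.
Qed.

Lemma rV_norm_coord (x : X) i : `|x 0 i| <= `|x|.
Proof.
rewrite [leRHS]mx_normrE (le_trans _ (@le_bigmax _ _ _ 0 (fun ij => `|x ij.1 ij.2|) (0, i)))//.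
Qed.

Definition cube (M : R) : set X := [set x | forall i, `[- M, M]%classic (x 0 i)].

Lemma measurable_cube M : measurable (cube M).
Proof.
apply: (measurable_rV_box (A := fun=> `[- M, M]%classic)) => i.
exact: measurable_itv.
Qed.

Lemma compact_sub_cube (A : set X) : compact A -> exists M : R, A `<=` cube M.
Proof.
move=> /compact_bounded [M [_ HM]]; exists (M + 1) => x Ax i.
have H : `|x| <= M + 1 by apply: (HM (M + 1)) => //; rewrite ltrDl.
rewrite /= in_itv /= -ler_norml; exact: le_trans (rV_norm_coord x i) H.
Qed.

Lemma lebesgue_rV_cube M : (mu (cube M) < +oo)%E.
Proof.
rewrite /cube (lebesgue_rV_box (A := fun=> `[- M, M]%classic)) => [|i]; last exact: measurable_itv.
rewrite ltey_eq prode_fin_num// => i _.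
by rewrite lebesgue_measure_itv /=; case: ifP.
Qed.

End rV_topology.

Section test_functions.
Context {R : realType} (d : nat) (Omega : set 'rV[R]_d).
Local Notation X := 'rV[R]_d.
Local Notation mu := (lebesgue_rV d).
Implicit Types (phi psi : X -> R).

Lemma closed_supp_le phi psi :
  (forall x, ~ closure [set x | phi x != 0] x -> psi x = 0) ->
  closure [set x | psi x != 0] `<=` closure [set x | phi x != 0].
Proof.
move=> H; rewrite [X in _ `<=` X](_ : _ = closure (closure [set x | phi x != 0])).
  apply: closureS => x /= px; apply: contrapT => /H; exact/eqP.
by apply/closure_id; exact: closed_closure.
Qed.

Lemma test_function_partial phi i :
  test_function Omega phi -> test_function Omega (partial i phi).
Proof.
move=> [sphi cphi sO].
have sub : closure [set x | partial i phi x != 0] `<=` closure [set x | phi x != 0].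
  apply: closed_supp_le => x nx; rewrite /partial.
  rewrite (@near_eq_derive _ _ _ phi (cst 0)) ?derive_cst//.
  have : open (~` closure [set x | phi x != 0]).
    by apply: closed_openC; exact: closed_closure.
  rewrite openE => /(_ _ nx); apply: filterS => y /= ny.
  apply: contrapT => /eqP py; exact/ny/subset_closure.
split.
- move=> s; rewrite -[partial i phi]/(foldr (@partial R d) phi [:: i]) -foldr_cat.
  exact: sphi.
- by apply: subclosed_compact cphi sub; exact: closed_closure.
- exact: subset_trans sO.
Qed.

Lemma foldr_partial_lin (a : R) phi psi s : smooth phi -> smooth psi ->
  foldr (@partial R d) (fun x => a * phi x + psi x) s =
  (fun x => a * foldr (@partial R d) phi s x + foldr (@partial R d) psi s x).
Proof.
move=> sphi spsi; elim: s => //= i s ->; apply/funext => x; rewrite {1}/partial.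
have d1 := (sphi s).2 i x; have d2 := (spsi s).2 i x.
have := deriveD (@derivableZ _ _ _ _ a _ _ d1) d2.
by rewrite (deriveZ a d1); exact.
Qed.

Lemma smooth_lin (a : R) phi psi : smooth phi -> smooth psi ->
  smooth (fun x => a * phi x + psi x).
Proof.
move=> sphi spsi s; rewrite foldr_partial_lin//; split.
  move=> x; pose F := foldr (@partial R d) phi s.
  apply: (@continuousD R _ _ (fun y => a * F y) (foldr (@partial R d) psi s) x).
    apply: (@continuousM R _ (fun=> a) F x); first by apply: cst_continuous.
    exact: (sphi s).1.
  exact: (spsi s).1.
move=> i x; apply: derivableD; last exact: (spsi s).2.
by apply: (@derivableZ _ _ _ _ a); exact: (sphi s).2.
Qed.

Lemma test_function_lin (a : R) phi psi :
  test_function Omega phi -> test_function Omega psi ->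
  test_function Omega (fun x => a * phi x + psi x).
Proof.
move=> [s1 c1 O1] [s2 c2 O2].
have sub : closure [set x | a * phi x + psi x != 0] `<=`
    closure [set x | phi x != 0] `|` closure [set x | psi x != 0].
  rewrite -closureU; apply: closureS => x /= H.
  have [p0|p0] := eqVneq (phi x) 0; last by left.
  by right; apply: contra H => /eqP ->; rewrite p0 mulr0 addr0.
split; first exact: smooth_lin.
  by apply: subclosed_compact (compactU c1 c2) sub; exact: closed_closure.
by move=> x /sub [/O1|/O2].
Qed.

Lemma gradient_lin (a : R) phi psi : test_function Omega phi ->
  test_function Omega psi -> forall x,
  gradient (fun x => a * phi x + psi x) x = a *: gradient phi x + gradient psi x.
Proof.
move=> [s1 _ _] [s2 _ _] x; apply/rowP => i; rewrite !mxE.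
by have /(congr1 (@^~ x)) := foldr_partial_lin a [:: i] s1 s2.
Qed.

(** A test function is bounded and vanishes off a cube, which has finite measure. *)
Lemma test_function_L2 phi : measurable Omega -> test_function Omega phi ->
  L2 mu Omega phi.
Proof.
move=> mO [sphi cphi _]; have [cf _] := sphi [::].
have mphi : measurable_fun [set: X] phi by exact: continuous_rV_measurable.
suff LT : L2 mu setT phi by apply: L2_subset LT.
apply/L2P; split => //.
have [M HM] := compact_sub_cube cphi; pose B : set X := cube M.
have mB : measurable B by exact: measurable_cube.
have [K HK] : exists K : R, forall x, `|phi x| <= K.
  have /compact_bounded [K [_ HK]] : compact (phi @` closure [set x | phi x != 0]).
    by apply: continuous_compact => //; exact: continuous_subspaceT.
  (* Compactness only yields bounds strictly above [K], hence [K + 1]; the [0] serves the points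
     where [phi] vanishes. *)
  exists (Num.max 0 (K + 1)) => x; have [->|p0] := eqVneq (phi x) 0.
    by rewrite normr0 le_max lexx.
  rewrite le_max; apply/orP; right; apply: (HK (K + 1)); first by rewrite ltrDl.
  by exists x => //; exact: subset_closure.
have E : (EFin \o (fun x => phi x ^+ 2)) = (EFin \o (fun x => phi x ^+ 2)) \_ B.
  apply/funext => x; rewrite patchE; case: ifPn => //= /negP nB.
  suff -> : phi x = 0 by rewrite expr0n.
  apply/eqP/negPn/negP => p0; apply: nB; apply/mem_set/HM; exact: subset_closure.
rewrite E -integrable_mkcond//; apply: measurable_bounded_integrable => //.
- exact: lebesgue_rV_cube.
- by apply: measurable_funX; exact: measurable_funS mphi.
exists (K ^+ 2); split; first exact: num_real.
move=> r Kr x _ /=; rewrite (le_trans _ (ltW Kr))// normrX ler_pXn2r ?nnegrE//.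
exact: le_trans (HK x).
Qed.

Lemma gradientE phi x i : gradient phi x 0 i = partial i phi x.
Proof. by rewrite mxE. Qed.

End test_functions.

Local Opaque partial gradient.

Lemma eq_le_refl (R : realType) (x y : R) : x = y -> x <= y.
Proof. by move=> ->. Qed.

(** Tolerances for approximating $a v + w$; the [+ 1] keeps the denominator positive when [a] is
    zero. *)
Lemma small_lin (R : realType) (a e x y : R) :
  x < e / (4 * (a ^+ 2 + 1)) -> y < e / 4 -> 0 <= x -> 2 * (a ^+ 2 * x) + 2 * y < e.
Proof.
have a1 : 0 < 4 * (a ^+ 2 + 1) by rewrite mulr_gt0// ltr_wpDl// sqr_ge0.
rewrite ltr_pdivlMr// => xe ye x0; nra.
Qed.

Lemma small_diff (R : realType) (e x y z t : R) :
  x <= (x + y) / 2 -> y <= 2 * ((-1) ^+ 2 * z) + 2 * t ->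
  t < e / 4 -> z < e / 4 -> x <= e.
Proof. by rewrite sqrrN expr1n mul1r; lra. Qed.

(** * The closure of the test functions and uniqueness of the weak gradient *)

Section H10_theory.
Context {R : realType} (d : nat) (Omega : set 'rV[R]_d) (mO : measurable Omega).
Local Notation X := 'rV[R]_d.
Local Notation mu := (lebesgue_rV d).
Implicit Types (v w : X -> R) (g h : X -> 'rV[R]_d).

Lemma gradient_L2 phi : test_function Omega phi -> L2v mu Omega (gradient phi).
Proof.
move=> tphi i; apply: eq_L2 (test_function_L2 mO (test_function_partial i tphi)) => x _.
by rewrite gradientE.
Qed.

Lemma eq_H10_with v w g h : (forall x, Omega x -> v x = w x) ->
  (forall x, Omega x -> g x = h x) -> H10_with Omega v g -> H10_with Omega w h.
Proof.
move=> vw gh [[Lv Lg wg] ap]; split; first split.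
- exact: eq_L2 Lv.
- by move=> i; apply: eq_L2 (Lg i) => x Ox; rewrite gh.
- move=> phi tphi i; have := wg phi tphi i.
  rewrite (@eq_L2ip _ _ _ mu Omega v w (partial i phi) (partial i phi))// => ->.
  by congr (- _); apply: eq_L2ip => // x Ox; rewrite gh.
move=> e e0; have [phi tphi H] := ap e e0; exists phi => //; move: H.
rewrite (@eq_L2norm _ _ _ mu Omega _ (w \- phi)) => [|x Ox /=]; last by rewrite vw.
rewrite /L2vnorm2; under eq_bigr => i _.
  rewrite (@eq_L2norm _ _ _ mu Omega _ (fun x => (h \- gradient phi) x 0 i)); last first.
    by move=> x Ox /=; rewrite gh.
  over.
by [].
Qed.

(** The squared H^1 distance as a real number, so that approximation arguments avoid extended
    reals. *)
Definition H1dist2 v g phi : R :=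
  L2ip mu Omega (v \- phi) (v \- phi) +
  \sum_i L2ip mu Omega (fun x => (g x - gradient phi x) 0 i)
                       (fun x => (g x - gradient phi x) 0 i).

Lemma H1dist2_ge0 v g phi : 0 <= H1dist2 v g phi.
Proof. by rewrite addr_ge0 ?L2ip_ge0// sumr_ge0// => i _; exact: L2ip_ge0. Qed.

Lemma H1dist2E v g phi : L2 mu Omega v -> L2v mu Omega g -> test_function Omega phi ->
  (L2norm mu Omega (v \- phi)%R ^+ 2 + L2vnorm2 mu Omega (g \- gradient phi)%R)%E
  = (H1dist2 v g phi)%:E.
Proof.
move=> Lv Lg tphi; rewrite EFinD L2norm_ip//; last first.
  by apply: L2_B => //; exact: test_function_L2.
congr (_ + _)%E; rewrite /L2vnorm2 -sumEFin; apply: eq_bigr => i _.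
rewrite L2norm_ip//; apply: (@eq_L2 _ _ _ _ _ (fun x => g x 0 i - gradient phi x 0 i)).
  by move=> x _; rewrite !(mxE, gradientE).
by apply: L2_B => //; exact: gradient_L2.
Qed.

Lemma H10_withP v g : H10_with Omega v g <-> H1_with Omega v g /\
  forall e : R, 0 < e -> exists2 phi, test_function Omega phi & H1dist2 v g phi < e.
Proof.
split=> -[[Lv Lg wg] ap]; split=> // e e0; have [phi tphi H] := ap e e0;
  exists phi => //; move: H; rewrite (H1dist2E Lv Lg tphi) lte_fin//.
Qed.

Lemma L2ip_lin_le (a : R) f f' : L2 mu Omega f -> L2 mu Omega f' ->
  L2ip mu Omega (fun x => a * f x + f' x) (fun x => a * f x + f' x) <=
  2 * (a ^+ 2 * L2ip mu Omega f f) + 2 * L2ip mu Omega f' f'.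
Proof.
move=> Lf Lf'; have Laf := L2_Z mO a Lf; have Lff := L2_D mO Laf Lf'.
rewrite (L2ipDl mO Laf Lf' Lff) L2ipC (L2ipDl mO Laf Lf' Laf).
rewrite [X in _ + X]L2ipC (L2ipDl mO Laf Lf' Lf').
have E : L2ip mu Omega (fun x => a * f x) (fun x => a * f x) = a ^+ 2 * L2ip mu Omega f f.
  by rewrite (L2ipZl mO a Lf Laf) L2ipC (L2ipZl mO a Lf Lf) mulrA.
rewrite [L2ip _ _ f' (fun x => a * f x)]L2ipC.
have := L2ip_young mO Laf Lf'; rewrite E.
have gen (x y z : R) : y <= (x + z) / 2 -> x + y + (y + z) <= 2 * x + 2 * z by lra.
exact: gen.
Qed.

Lemma H10_with_lin (a : R) v w g h : H10_with Omega v g -> H10_with Omega w h ->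
  H10_with Omega (fun x => a * v x + w x) (fun x => a *: g x + h x).
Proof.
move=> /H10_withP[[Lv Lg wg] av] /H10_withP[[Lw Lh wh] aw].
have LL : L2 mu Omega (fun x => a * v x + w x) by apply: L2_D => //; exact: L2_Z.
have LGi i : L2 mu Omega (fun x => a * g x 0 i + h x 0 i).
  by apply: L2_D => //; exact: L2_Z.
have LG : L2v mu Omega (fun x => a *: g x + h x).
  by move=> i; apply: eq_L2 (LGi i) => x _; rewrite !(mxE, gradientE).
apply/H10_withP; split; first split => //.
- move=> phi tphi i.
  have Lp := test_function_L2 mO tphi.
  have Ldp := test_function_L2 mO (test_function_partial i tphi).
  rewrite L2ipDl//; last exact: L2_Z.
  rewrite (L2ipZl mO a Lv Ldp) wg// wh// mulrN -opprD; congr (- _).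
  transitivity (L2ip mu Omega (fun x => a * g x 0 i + h x 0 i) phi); last first.
    by apply: eq_L2ip => // x _; rewrite !(mxE, gradientE).
  by rewrite (L2ipDl mO (L2_Z mO a (Lg i)) (Lh i) Lp) (L2ipZl mO a (Lg i) Lp).
move=> e e0.
(* Doubling and multiplying by [a ^+ 2] leaves at most half of [e] for the first error; the
   tolerance [e / 4] leaves the other half for the second. *)
have e1 : 0 < e / (4 * (a ^+ 2 + 1)).
  by rewrite divr_gt0// mulr_gt0// ltr_wpDl// sqr_ge0.
have e2 : 0 < e / 4 by rewrite divr_gt0.
have [phi tphi Hphi] := av _ e1; have [psi tpsi Hpsi] := aw _ e2.
exists (fun x => a * phi x + psi x); first exact: test_function_lin.
have Lvp : L2 mu Omega (v \- phi) by apply: L2_B => //; exact: test_function_L2.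
have Lwp : L2 mu Omega (w \- psi) by apply: L2_B => //; exact: test_function_L2.
have Lgp i : L2 mu Omega (fun x => (g x - gradient phi x) 0 i).
  apply: (@eq_L2 _ _ _ _ _ (fun x => g x 0 i - gradient phi x 0 i)).
    by move=> x _; rewrite !(mxE, gradientE).
  by apply: L2_B => //; exact: gradient_L2.
have Lhp i : L2 mu Omega (fun x => (h x - gradient psi x) 0 i).
  apply: (@eq_L2 _ _ _ _ _ (fun x => h x 0 i - gradient psi x 0 i)).
    by move=> x _; rewrite !(mxE, gradientE).
  by apply: L2_B => //; exact: gradient_L2.
apply: (@le_lt_trans _ _ (2 * (a ^+ 2 * H1dist2 v g phi) + 2 * H1dist2 w h psi)).
  have sumE (x y x' y' : R) :
      2 * (a ^+ 2 * (x + y)) + 2 * (x' + y') =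
      (2 * (a ^+ 2 * x) + 2 * x') + (2 * (a ^+ 2 * y) + 2 * y') by ring.
  rewrite [leRHS]sumE; apply: lerD.
    apply: le_trans (L2ip_lin_le a Lvp Lwp); apply: eq_le_refl.
    by apply: eq_L2ip => x _ /=; ring.
  have sumE2 (F G : 'I_d -> R) :
      2 * (a ^+ 2 * \sum_i F i) + 2 * \sum_i G i = \sum_i (2 * (a ^+ 2 * F i) + 2 * G i).
    by rewrite !mulr_sumr -big_split.
  rewrite [leRHS]sumE2; apply: ler_sum => i _.
  apply: le_trans (L2ip_lin_le a (Lgp i) (Lhp i)); apply: eq_le_refl.
  have lin (x y z t : R) : a * x + y - (a * z + t) = a * (x - z) + (y - t) by ring.
  by apply: eq_L2ip => x _ /=; rewrite (gradient_lin a tphi tpsi) !mxE lin.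
exact: small_lin Hphi Hpsi (H1dist2_ge0 v g phi).
Qed.

Lemma H10_grad_unique v g h : H10_with Omega v g -> H10_with Omega v h ->
  forall i, L2ip mu Omega (fun x => g x 0 i - h x 0 i) (fun x => g x 0 i - h x 0 i) = 0.
Proof.
move=> /H10_withP[[Lv Lg wg] ag] /H10_withP[[_ Lh wh] ah] i.
set D := fun x => _; have LD : L2 mu Omega D by apply: L2_B.
have orth phi : test_function Omega phi -> L2ip mu Omega D phi = 0.
  move=> tphi; have Lp := test_function_L2 mO tphi.
  rewrite (L2ipBl mO (Lg i) (Lh i) Lp); have := wg phi tphi i; rewrite (wh phi tphi i) => /eqP.
  by rewrite eqr_opp => /eqP ->; rewrite subrr.
set I := L2ip mu Omega D D; have I0 : 0 <= I := L2ip_ge0 _ _ _.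
apply/eqP; rewrite eq_le I0 andbT; apply/ler_addgt0Pr => e e0; rewrite add0r.
have e4 : 0 < e / 4 by rewrite divr_gt0.
have [phi tphi Hphi] := ag _ e4; have [psi tpsi Hpsi] := ah _ e4.
pose A x := (g x - gradient phi x) 0 i; pose B x := (h x - gradient psi x) 0 i.
have Lpp := test_function_L2 mO (test_function_partial i tphi).
have Lqq := test_function_L2 mO (test_function_partial i tpsi).
have LA : L2 mu Omega A.
  apply: (@eq_L2 _ _ _ _ _ (fun x => g x 0 i - partial i phi x)).
    by move=> x _; rewrite /A !(mxE, gradientE).
  exact: L2_B.
have LB : L2 mu Omega B.
  apply: (@eq_L2 _ _ _ _ _ (fun x => h x 0 i - partial i psi x)).
    by move=> x _; rewrite /B !(mxE, gradientE).
  exact: L2_B.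
(* Partial derivatives of test functions are test functions, so [D] is orthogonal to them and pairs
   only with the approximation errors [A] and [B]. *)
have EI : I = L2ip mu Omega D (fun x => (-1) * B x + A x).
  have LBA : L2 mu Omega (fun x => (-1) * B x + A x).
    by apply: L2_D => //; exact: L2_Z.
  rewrite /I (@eq_L2ip _ _ _ mu Omega D D D
    (fun x => ((-1) * B x + A x) - (partial i psi x - partial i phi x)))//; last first.
    by move=> x _; rewrite /D /A /B !(mxE, gradientE); ring.
  rewrite (L2ipBr mO LBA (L2_B mO Lqq Lpp) LD) (L2ipBr mO Lqq Lpp LD).
  rewrite (orth _ (test_function_partial i tpsi)).
  by rewrite (orth _ (test_function_partial i tphi)) subrr subr0.
have dA : L2ip mu Omega A A < e / 4.
  apply: le_lt_trans Hphi; rewrite /H1dist2 (bigD1 i)//= addrCA ler_wpDr//.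
  by rewrite addr_ge0 ?L2ip_ge0// sumr_ge0// => *; exact: L2ip_ge0.
have dB : L2ip mu Omega B B < e / 4.
  apply: le_lt_trans Hpsi; rewrite /H1dist2 (bigD1 i)//= addrCA ler_wpDr//.
  by rewrite addr_ge0 ?L2ip_ge0// sumr_ge0// => *; exact: L2ip_ge0.
have LBA : L2 mu Omega (fun x => (-1) * B x + A x).
  by apply: L2_D => //; exact: L2_Z.
have Y := L2ip_young mO LD LBA; rewrite -EI -/I in Y.
have Z := L2ip_lin_le (-1) LB LA.
exact: small_diff Y Z dA dB.
Qed.

End H10_theory.

(** * Polynomials in time on a slab *)

Section product_sets.
Context d1 d2 (T1 : measurableType d1) (T2 : measurableType d2) (R : realType).
Variables (m1 : {sigma_finite_measure set T1 -> \bar R})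
  (m2 : {sigma_finite_measure set T2 -> \bar R}).
Variables (A : set T1) (B : set T2) (mA : measurable A) (mB : measurable B).

Let mAB : measurable (A `*` B). Proof. exact: measurableX. Qed.

Lemma measurable_sliceX (f : T1 * T2 -> R) y : measurable_fun (A `*` B) f -> B y ->
  measurable_fun A (fun x => f (x, y)).
Proof.
move=> mf By; apply/(measurable_restrictT _ mA).
have mf' := (measurable_restrictT f mAB).1 mf.
rewrite (_ : _ \_ A = (f \_ (A `*` B)) \o (fun x => (x, y))).
  by apply: measurableT_comp => //; exact: pair2_measurable.
apply/funext => x /=; rewrite !patchE; case: ifPn => xA; case: ifPn => // xAB.
  by move: xAB; rewrite mem_set//; split=> //=; exact: set_mem.
by move: xAB xA => /set_mem[/= /mem_set ->].
Qed.

(** Restricting to a rectangle restricts each variable separately, which carries Tonelli's theorem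
    from the whole product to [A] times [B]. *)
Lemma restrictX (f : T1 * T2 -> \bar R) x y :
  (f \_ (A `*` B)) (x, y) =
  ((fun y => (((fun x => f (x, y)) \_ A) x)) \_ B) y.
Proof.
rewrite !patchE; case: ifPn => xyAB.
  by have [/= /mem_set -> /mem_set ->] := set_mem xyAB.
case: ifPn => yB //; case: ifPn => xA //.
by move: xyAB; rewrite mem_set//; split=> /=; exact: set_mem.
Qed.

Lemma integral_restrictX (f : T1 * T2 -> \bar R) y :
  (\int[m1]_x (f \_ (A `*` B)) (x, y) =
   ((fun y => \int[m1]_(x in A) f (x, y)) \_ B) y)%E.
Proof.
under eq_integral do rewrite restrictX.
rewrite patchE; case: ifPn => yB.
  rewrite [RHS]integral_mkcond; apply: eq_integral => x _.
  by rewrite patchE yB.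
by under eq_integral do rewrite patchE (negbTE yB); rewrite integral0.
Qed.

Section tonelliX.
Variables (f : T1 * T2 -> \bar R) (mf : measurable_fun (A `*` B) f).
Hypothesis f0 : forall z, (A `*` B) z -> (0 <= f z)%E.

Let g := f \_ (A `*` B).
Let g0 z : (0 <= g z)%E.
Proof. by rewrite /g patchE; case: ifPn => // /set_mem /f0. Qed.
Let mg : measurable_fun setT g.
Proof. exact: (measurable_restrictT f mAB).1. Qed.

Lemma tonelliX :
  (\int[m1 \x m2]_(z in A `*` B) f z = \int[m2]_(y in B) \int[m1]_(x in A) f (x, y))%E.
Proof.
rewrite integral_mkcond (@fubini_tonelli2 _ _ _ _ _ m1 m2 g mg g0).
rewrite [RHS]integral_mkcond; apply: eq_integral => y _.
by rewrite /fubini_G integral_restrictX.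
Qed.

Lemma measurable_integralX : measurable_fun B (fun y => \int[m1]_(x in A) f (x, y))%E.
Proof.
apply/(measurable_restrictT _ mB).
rewrite (_ : _ \_ B = fubini_G m1 g).
  exact: measurable_fun_fubini_tonelli_G.
by apply/funext => y; rewrite /fubini_G integral_restrictX.
Qed.

End tonelliX.

Variables (g : T1 -> R) (th : T2 -> R).
Hypotheses (Ig : m1.-integrable A (EFin \o g)) (Ith : m2.-integrable B (EFin \o th)).

Lemma measurable_prodX (g' : T1 -> R) (th' : T2 -> R) :
  measurable_fun A g' -> measurable_fun B th' ->
  measurable_fun (A `*` B) (fun z => g' z.1 * th' z.2).
Proof.
move=> mg mth.
have mg' := (measurable_restrictT g' mA).1 mg.
have mth' := (measurable_restrictT th' mB).1 mth.
have mm : measurable_fun setT (fun z : T1 * T2 => (g' \_ A) z.1 * (th' \_ B) z.2).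
  apply: measurable_funM; first exact: measurableT_comp mg' measurable_fst.
  exact: measurableT_comp mth' measurable_snd.
apply: eq_measurable_fun (measurable_funTS mm) => z /set_mem[/= zA zB].
by rewrite !patchE !mem_set.
Qed.

Lemma integrable_prodX : (m1 \x m2)%E.-integrable (A `*` B) (fun z => (g z.1 * th z.2)%:E).
Proof.
have mgth : measurable_fun (A `*` B) (fun z => g z.1 * th z.2).
  by apply: measurable_prodX; apply/measurable_EFinP;
    [exact: measurable_int Ig|exact: measurable_int Ith].
apply/integrableP; split; first exact/measurable_EFinP.
rewrite tonelliX//; last by apply: measurableT_comp => //; exact/measurable_EFinP.
have /integrableP[mth th_lt] := Ith; have /integrableP[mg g_lt] := Ig.
rewrite (eq_integral (fun y => `|(EFin \o th) y| * \int[m1]_(x in A) `|(EFin \o g) x|))%E.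
  rewrite ge0_integralZr//.
  - by rewrite lte_mul_pinfty// ?integral_ge0// ge0_fin_numE// integral_ge0.
  - exact: measurableT_comp.
  - exact: integral_ge0.
move=> y _ /=; rewrite -ge0_integralZl//.
- by apply: eq_integral => x _; rewrite -EFinM normrM mulrC.
- apply/measurable_EFinP; apply: measurableT_comp => //; exact/measurable_EFinP.
Qed.

Lemma Rintegral_prodX :
  \int[(m1 \x m2)%E]_(z in A `*` B) (g z.1 * th z.2) =
  (\int[m1]_(x in A) g x) * (\int[m2]_(y in B) th y).
Proof.
have Ip := integrable_prodX.
have Ip' := (integrable_mkcond _ mAB).1 Ip.
rewrite /Rintegral integral_mkcond -integral21_prod_meas1//.
transitivity (fine (\int[m2]_y
    ((fun y => (fine (\int[m1]_(x in A) (g x)%:E))%:E * (th y)%:E) \_ B) y)%E).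
  congr fine; apply: eq_integral => y _.
  rewrite /fubini_G integral_restrictX !patchE; case: ifPn => // yB.
  rewrite fineK; last exact: integrable_fin_num.
  rewrite muleC -integralZl//; apply: eq_integral => x _.
  by rewrite /= -EFinM mulrC.
rewrite -integral_mkcond integralZl// fineM//.
exact: integrable_fin_num.
Qed.

End product_sets.

(** * Moments of the rescaled time *)

Section time_interval.
Context {R : realType}.
Local Notation leb := (@lebesgue_measure R).

Definition sg (a b s : R) : R := (s - a) / (b - a).

Variables (a b : R) (ab : a < b).

Lemma sg_bounds s : a < s < b -> 0 <= sg a b s <= 1.
Proof.
move=> /andP[as_ sb]; have ba : 0 < b - a by rewrite subr_gt0.
apply/andP; split; first by apply: divr_ge0; rewrite ltW// subr_gt0.
by rewrite ler_pdivrMr// mul1r lerD2r ltW.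
Qed.

Lemma is_derive_sgX n s :
  is_derive s (1 : R) (fun r : R => sg a b r ^+ n.+1) ((n.+1%:R / (b - a)) * sg a b s ^+ n).
Proof.
pose P : {poly R} := (((b - a)^-1)%:P * ('X - a%:P)) ^+ n.+1.
have PE : (fun r => sg a b r ^+ n.+1) = horner P.
  by apply/funext => r; rewrite /P !hornerE mulrC.
rewrite PE; apply: is_derive_eq.
rewrite /P deriv_exp derivM derivC mul0r add0r derivB derivX derivC subr0 mulr1.
rewrite hornerMn hornerCM horner_exp hornerCM hornerXsubC /=.
by rewrite -[LHS]mulr_natl mulrA /sg [(s - a) / _]mulrC.
Qed.

Lemma measurable_sgX n (D : set R) : measurable D ->
  measurable_fun D (fun s => sg a b s ^+ n).
Proof.
move=> mD; apply: measurable_funX; apply: measurable_funM => //.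
by apply: measurable_funB => //; exact: measurable_cst.
Qed.

Lemma lebesgue_itv_fin : (leb `]a, b[%classic < +oo)%E.
Proof. by rewrite lebesgue_measure_itv /= lte_fin ab -EFinB ltry. Qed.

Lemma integrable_sgX n : leb.-integrable `]a, b[%classic (EFin \o (fun s => sg a b s ^+ n)).
Proof.
apply: measurable_bounded_integrable => //.
- exact: lebesgue_itv_fin.
- exact: measurable_sgX.
exists 1; split; first exact: num_real.
move=> r r1 s /=; rewrite in_itv /= => /sg_bounds /andP[s0 s1].
by rewrite (le_trans _ (ltW r1))// normrX ger0_norm// exprn_ile1.
Qed.

(** Up to the factor [b - a], these moments are the entries of the Hilbert matrix. *)
Lemma Rintegral_sgX n :
  \int[leb]_(s in `]a, b[%classic) (sg a b s ^+ n) = (b - a) / n.+1%:R.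
Proof.
have ba : b - a != 0 by rewrite gt_eqF// subr_gt0.
have n0 : n.+1%:R != 0 :> R by rewrite pnatr_eq0.
pose F s := ((b - a) / n.+1%:R) * sg a b s ^+ n.+1.
have dF s : is_derive s (1 : R) F (sg a b s ^+ n).
  have H := is_derive_sgX n s.
  have scE (m x : R) : m != 0 -> x = ((b - a) / m) * ((m / (b - a)) * x).
    by move=> m0; field; rewrite ?m0 ?ba.
  by rewrite (scE _ (sg a b s ^+ n) n0); exact: is_deriveZ.
have cF : continuous F.
  by move=> s; apply: differentiable_continuous; apply/derivable1_diffP; exact: ex_derive.
have csg : continuous (fun s => sg a b s ^+ n).
  move=> s; apply: differentiable_continuous; apply/derivable1_diffP.
  case: n {F dF cF n0} => [|n]; first by apply: ex_derive; apply: is_derive_cst.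
  by case: (is_derive_sgX n s).
have E := @continuous_FTC2 R (fun s => sg a b s ^+ n) F a b ab.
have Icc : leb.-integrable `[a, b]%classic (EFin \o (fun s => sg a b s ^+ n)).
  apply: continuous_compact_integrable; last exact: continuous_subspaceT.
  exact: segment_compact.
rewrite Rintegral_itv_bndo_bndc; last exact: integrable_sgX.
rewrite Rintegral_itv_obnd_cbnd; last first.
  by apply: integrableS Icc => //; exact: subset_itv_oc_cc.
rewrite /Rintegral E.
- by rewrite -EFinB /= /F /sg subrr mul0r expr0n /= mulr0 subr0 divff// expr1n mulr1.
- exact: continuous_subspaceT.
- split.
  + by move=> s _; exact: ex_derive.
  + by apply: cvg_at_right_filter; exact: cF.
  + by apply: cvg_at_left_filter; exact: cF.
- by move=> s _; rewrite derive1E; exact: derive_val.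
Qed.

End time_interval.

(** * Inner products, traces and the load on one slab *)

Section slab_theory.
Context {R : realType} (d q : nat) (Omega : set 'rV[R]_d) (mO : measurable Omega).
Local Notation X := 'rV[R]_d.
Local Notation XT := ('rV[R]_d * measurableTypeR R)%type.
Local Notation mu := (lebesgue_rV d).
Local Notation muT := (@st_measure R d).
Local Notation leb := (@lebesgue_measure R).
Variables (a b : R) (ab : a < b).
Local Notation Q := (slab Omega a b).
Implicit Types (w : 'I_q.+1 -> X -> R).

Lemma measurable_slab (s t : R) : measurable (slab Omega s t).
Proof. by apply: measurableX => //; exact: measurable_itv. Qed.

Let mQ : measurable Q := measurable_slab a b.

Let mI : measurable (`]a, b[%classic : set (measurableTypeR R)).
Proof. exact: measurable_itv. Qed.

Definition tpoly w (z : XT) : R := \sum_(j < q.+1) sg a b z.2 ^+ j * w j z.1.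

(** For [j = 0] the factor [j%:R] vanishes, so the truncated exponent [j.-1] does no harm. *)
Definition dtpoly w (z : XT) : R :=
  \sum_(j < q.+1) j%:R / (b - a) * (sg a b z.2 ^+ j.-1 * w j z.1).

Lemma L2_sgX n (f : X -> R) : L2 mu Omega f ->
  L2 muT Q (fun z => sg a b z.2 ^+ n * f z.1).
Proof.
move=> /L2P[mf If]; apply/L2P; split.
  apply: eq_measurable_fun (measurable_prodX mO mI mf (measurable_sgX a b n mI)) => z _.
  by rewrite mulrC.
have := integrable_prodX mO mI If (integrable_sgX ab (n * 2)).
apply: eq_integrable => // z _ /=.
by rewrite [in RHS]exprMn exprM mulrC.
Qed.

Lemma L2ip_sgX m n (f g : X -> R) : L2 mu Omega f -> L2 mu Omega g ->
  L2ip muT Q (fun z => sg a b z.2 ^+ m * f z.1) (fun z => sg a b z.2 ^+ n * g z.1) =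
  (b - a) * ((m + n).+1%:R^-1 * L2ip mu Omega f g).
Proof.
move=> Lf Lg; rewrite !L2ipE.
have := Rintegral_prodX mO mI (L2_prod mO Lf Lg) (integrable_sgX ab (m + n)).
rewrite Rintegral_sgX// => E; rewrite mulrA mulrC -E.
by apply: eq_Rintegral => z _; rewrite exprD mulrACA mulrC.
Qed.

Lemma L2_tpoly w : (forall j, L2 mu Omega (w j)) -> L2 muT Q (tpoly w).
Proof. by move=> Lw; apply: L2_sum => // j; exact: L2_sgX. Qed.

Lemma L2ip_tpoly w (z : 'I_q.+1 -> X -> R) : (forall j, L2 mu Omega (w j)) -> (forall j, L2 mu Omega (z j)) ->
  L2ip muT Q (tpoly w) (tpoly z) = (b - a) * L2form mu Omega (hilbert_mx q) w z.
Proof.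
move=> Lw Lz; rewrite (L2ip_suml mQ _ _ _ (L2_tpoly Lz)); last by move=> j; exact: L2_sgX.
rewrite /L2form mulr_sumr; apply: eq_bigr => j _.
rewrite (L2ip_sumr mQ); [|by move=> k; exact: L2_sgX|exact: L2_sgX].
rewrite mulr_sumr; apply: eq_bigr => k _.
by rewrite L2ip_sgX// mxE.
Qed.

(** The factor [b - a] from integrating cancels the one from differentiating the rescaled time, so
    the form does not depend on the step length. *)
Lemma L2ip_dtpoly w (z : 'I_q.+1 -> X -> R) : (forall j, L2 mu Omega (w j)) -> (forall j, L2 mu Omega (z j)) ->
  L2ip muT Q (dtpoly w) (tpoly z) + L2ip mu Omega (w ord0) (z ord0) =
  L2form mu Omega (dg_mx q) w z.
Proof.
move=> Lw Lz; have ba : b - a != 0 by rewrite gt_eqF// subr_gt0.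
rewrite (L2ip_suml mQ _ _ _ (L2_tpoly Lz)); last first.
  by move=> j; apply: (L2_Z mQ); exact: L2_sgX.
have E (j : 'I_q.+1) : L2ip muT Q (fun x => j%:R / (b - a) * (sg a b x.2 ^+ j.-1 * w j x.1)) (tpoly z) =
    \sum_k (if j == ord0 then 0 else dg_mx q j k * L2ip mu Omega (w j) (z k)).
  rewrite (L2ipZl mQ _ (L2_sgX _ (Lw j)) (L2_tpoly Lz)).
  rewrite (L2ip_sumr mQ); [|by move=> k; exact: L2_sgX|exact: L2_sgX].
  rewrite mulr_sumr; apply: eq_bigr => k _; rewrite L2ip_sgX// mxE -val_eqE /=.
  case: (nat_of_ord j) => [|i] /=; first by rewrite !mul0r.
  by rewrite mulrA divfK// mulrA addSn.
under eq_bigr do rewrite E.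
(* Row [ord0] of [dg_mx] is the trace term; the other rows come from the derivative. *)
rewrite /L2form big_ord_recl [RHS]big_ord_recl /= big1// add0r addrC; congr (_ + _).
rewrite big_ord_recl [X in _ = _ + X]big1 ?addr0 ?mxE ?mul1r//.
by move=> k _; rewrite !mxE /= mul0r.
Qed.

Lemma is_derive_tpoly w x s :
  is_derive s (1 : R) (fun r : R => tpoly w (x, r)) (dtpoly w (x, s)).
Proof.
have H (j : 'I_q.+1) : is_derive s (1 : R) (w j x \*: (fun r : R => sg a b r ^+ j))
    (w j x *: (j%:R / (b - a) * sg a b s ^+ j.-1)).
  apply: is_deriveZ; case: (nat_of_ord j) => [|i] /=; last exact: is_derive_sgX.
  by rewrite !mul0r; exact: is_derive_cst.
have := is_derive_sum H; rewrite /dtpoly.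
rewrite (_ : \sum_(i < q.+1) w i x \*: _ = fun r => tpoly w (x, r)); last first.
  apply/funext => r; rewrite fct_sumE /tpoly; apply: eq_bigr => j _ /=.
  by rewrite mulrC.
rewrite (_ : \sum_(i < q.+1) w i x *: _ = dtpoly w (x, s))//.
by apply: eq_bigr => j _ /=; rewrite mulrA; exact: mulrC.
Qed.

Lemma continuous_tpoly w x : continuous (fun r : R => tpoly w (x, r)).
Proof.
move=> s; apply: differentiable_continuous; apply/derivable1_diffP.
by case: (is_derive_tpoly w x s).
Qed.

Lemma tpoly_left w x : tpoly w (x, a) = w ord0 x.
Proof.
rewrite /tpoly /sg subrr mul0r big_ord_recl expr0 mul1r big1 ?addr0// => j _.
by rewrite expr0n mul0r.
Qed.

Lemma tpoly_right w x : tpoly w (x, b) = \sum_j w j x.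
Proof.
rewrite /tpoly /sg divff ?gt_eqF ?subr_gt0//.
by apply: eq_bigr => j _; rewrite expr1n mul1r.
Qed.

Section traces.
Variables (u : XT -> R) (w : 'I_q.+1 -> X -> R) (x : X).
Hypothesis uw : forall s, a < s < b -> u (x, s) = tpoly w (x, s).

Lemma trace_right_tpoly : trace_right u a x = w ord0 x.
Proof.
rewrite -tpoly_left; apply: cvg_lim => //.
apply: cvg_trans (cvg_at_right_filter (@continuous_tpoly w x a)).
apply: near_eq_cvg; near=> s; rewrite uw//; apply/andP; split; near: s.
  exact: nbhs_right_gt.
exact: nbhs_right_lt.
Unshelve. all: by end_near. Qed.

Lemma trace_left_tpoly : trace_left u b x = \sum_j w j x.
Proof.
rewrite -tpoly_right; apply: cvg_lim => //.
apply: cvg_trans (cvg_at_left_filter (@continuous_tpoly w x b)).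
apply: near_eq_cvg; near=> s; rewrite uw//; apply/andP; split; near: s.
  exact: nbhs_left_gt.
exact: nbhs_left_lt.
Unshelve. all: by end_near. Qed.

Lemma dt_tpoly s : a < s < b -> dt u (x, s) = dtpoly w (x, s).
Proof.
move=> asb; rewrite /dt derive1E /=.
rewrite (@near_eq_derive _ _ _ _ (fun r : R => tpoly w (x, r))).
  by have [_ ->] := is_derive_tpoly w x s.
have /near_in_itvoo : s \in `]a, b[ by rewrite in_itv.
by apply: filterS => r; rewrite in_itv /= => /uw.
Qed.

End traces.

Lemma measurable_L2norm_slice (f : XT -> R) : measurable_fun Q f ->
  measurable_fun (`]a, b[%classic : set (measurableTypeR R))
    (fun s => L2norm mu Omega (slice f s)).
Proof.
move=> mf.
have mf2 : measurable_fun Q (fun z => (f z ^+ 2)%:E).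
  by apply/measurable_EFinP; exact: measurable_funX.
have f0 z : Q z -> (0 <= (f z ^+ 2)%:E)%E by rewrite lee_fin sqr_ge0.
have mi := measurable_integralX mu mO mI mf2 f0.
apply: eq_measurable_fun (measurableT_comp (measurable_poweR 2^-1) mi) => s _ /=.
rewrite L2normE poweR12_sqrt//.
by apply: integral_ge0 => x _; rewrite lee_fin sqr_ge0.
Qed.

Lemma L2norm_hoelder (f g : X -> R) : measurable_fun Omega f -> measurable_fun Omega g ->
  (\int[mu]_(x in Omega) `|(f x * g x)%:E| <= L2norm mu Omega f * L2norm mu Omega g)%E.
Proof.
move=> mf mg.
have h0 : (0 : R) < 2 by [].
have h1 : 2^-1 + 2^-1 = 1 :> R by rewrite -[LHS]mulr2n -[LHS]mulr_natl mulfV.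
have mf' := (measurable_restrictT f mO).1 mf.
have mg' := (measurable_restrictT g mO).1 mg.
have := hoelder mu mf' mg' h0 h0 h1.
rewrite Lnorm1 -!restrict_EFin; apply: le_trans.
rewrite [leLHS]integral_mkcond le_eqVlt; apply/orP; left; apply/eqP; apply: eq_integral => x _.
have z0 (r : R) : 0 * r = 0 by rewrite mul0r.
by rewrite /= !patchE; case: ifPn => _ //=; rewrite [X in `|X|]z0 normr0.
Qed.

(** The power of the rescaled time is bounded by 1 and [g] does not depend on time, so
    Cauchy-Schwarz is needed in space only. This is what leaves [f] in an L^1 norm in time. *)
Lemma L2ip_slab_le n (f : XT -> R) (g : X -> R) :
  L2 muT Q f -> L2 mu Omega g ->
  (\int[leb]_(s in `]a, b[) L2norm mu Omega (slice f s) < +oo)%E ->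
  `|L2ip muT Q f (fun z => sg a b z.2 ^+ n * g z.1)| <=
  fine (\int[leb]_(s in `]a, b[) L2norm mu Omega (slice f s))%E *
  Num.sqrt (L2ip mu Omega g g).
Proof.
move=> Lf Lg Foo; have [mf _] := Lf; have [mg _] := Lg.
have N0 : (0 <= \int[leb]_(s in `]a, b[) L2norm mu Omega (slice f s))%E.
  by apply: integral_ge0 => s _; exact: Lnorm_ge0.
have Ip := L2_prod mQ Lf (L2_sgX n Lg).
rewrite L2ipE -lee_fin EFin_normr_Rintegral// EFinM fineK ?ge0_fin_numE//.
rewrite -(L2norm_sqrt mO Lg).
have mfg : measurable_fun Q (fun z => f z * g z.1).
  apply: measurable_funM => //.
  have := measurable_prodX mO mI mg (@measurable_cst _ _ _ _ _ (1 : R)).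
  by apply: eq_measurable_fun => z _; rewrite mulr1.
apply: (@le_trans _ _ (\int[muT]_(z in Q) `|(f z * g z.1)%:E|)%E).
  apply: le_trans (le_abse_integral _ _ _) _ => //.
    exact: measurable_int Ip.
  apply: ge0_le_integral => //.
  - by apply: measurableT_comp => //; exact: measurable_int Ip.
  - by apply: measurableT_comp => //; exact/measurable_EFinP.
  - move=> z [_ /=]; rewrite in_itv /= => /(sg_bounds ab)/andP[s0 s1].
    rewrite lee_fin mulrCA normrM ler_piMl// normrX ger0_norm//.
    exact: exprn_ile1.
rewrite (tonelliX mu _ mO mI)//; last first.
  by apply: measurableT_comp => //; exact/measurable_EFinP.
rewrite -ge0_integralZr//.
- apply: ge0_le_integral => //.
  + by move=> s _; exact: integral_ge0.
  + have := measurable_integralX mu mO mI (f := fun z => `|(f z * g z.1)%:E|%E).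
    apply=> //.
    by apply: measurableT_comp => //; exact/measurable_EFinP.
  + apply: emeasurable_funM; [exact: measurable_L2norm_slice|exact: measurable_cst].
  + move=> s Is; apply: (L2norm_hoelder (f := slice f s)) => //.
    exact: (measurable_sliceX mO mI mf Is).
- exact: measurable_L2norm_slice.
- by move=> s _; exact: Lnorm_ge0.
- exact: Lnorm_ge0.
Qed.

End slab_theory.

(** * Extension by zero and changes on null sets *)

Section L2_extension.
Context {disp : measure_display} {X : measurableType disp} {R : realType}.
Variables (mu : {measure set X -> \bar R}) (D E : set X).
Hypotheses (mD : measurable D) (mE : measurable E) (ED : E `<=` D).
Variables (f f' : X -> R).
Hypotheses (ff' : forall x, E x -> f' x = f x).
Hypothesis f'0 : forall x, D x -> ~ E x -> f' x = 0.

Lemma L2ip_extend (h : X -> R) : L2ip mu D f' h = L2ip mu E f h.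
Proof.
rewrite !L2ipE Rintegral_mkcond [RHS]Rintegral_mkcond; apply: eq_Rintegral => x _.
rewrite !patchE; have [xE|xE] := pselect (E x).
  by rewrite !mem_set ?ff'//; exact: ED.
rewrite (memNset xE); case: ifPn => // /set_mem xD.
by rewrite f'0// mul0r.
Qed.

Lemma L2_extend : L2 mu E f -> L2 mu D f'.
Proof.
move=> /L2P[mf If]; apply/L2P; split.
  have mf' := (measurable_restrictT f mE).1 mf.
  apply: eq_measurable_fun (measurable_funTS mf') => x /set_mem xD.
  rewrite patchE; case: ifPn => [/set_mem xE|/negP xE]; first by rewrite ff'.
  by rewrite f'0// => xE'; apply: xE; exact: mem_set.
apply/integrable_mkcond => //; move/(integrable_mkcond _ mE): If.
apply: eq_integrable => // x _.
rewrite !patchE; have [xE|xE] := pselect (E x).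
  by rewrite !mem_set/= ?ff'//; exact: ED.
rewrite (memNset xE); case: ifPn => // /set_mem xD.
by rewrite /= f'0// expr0n.
Qed.

End L2_extension.

(** Meant for [Z] the time nodes, where the values of a discrete function are arbitrary;
    measurability of [g] must therefore be assumed. *)
Lemma L2_ae disp (X : measurableType disp) (R : realType)
    (mu : {measure set X -> \bar R}) (D Z : set X) (f g : X -> R) :
  measurable D -> measurable Z -> mu Z = 0%E -> measurable_fun D g ->
  (forall x, D x -> ~ Z x -> g x = f x) -> L2 mu D f -> L2 mu D g.
Proof.
move=> mD mZ Z0 mg gf [mf lf]; split=> //.
rewrite (_ : L2norm mu D g = L2norm mu D f)// !L2normE; congr sqrte.
have m2 (h : X -> R) : measurable_fun D h -> measurable_fun D (fun x => (h x ^+ 2)%:E).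
  by move=> mh; apply/measurable_EFinP; exact: measurable_funX.
have s0 (h : X -> R) x : D x -> (0 <= (h x ^+ 2)%:E)%E by rewrite lee_fin sqr_ge0.
rewrite (ge0_negligible_integral mZ mD (m2 _ mg) (s0 g) Z0).
rewrite (ge0_negligible_integral mZ mD (m2 _ mf) (s0 f) Z0).
by apply: eq_integral => x /set_mem[xD xZ]; rewrite gf.
Qed.

Section H10_sums.
Context {R : realType} (d : nat) (Omega : set 'rV[R]_d) (mO : measurable Omega).
Local Notation X := 'rV[R]_d.

(** Obtained as $-v + v$, so that no test function has to be exhibited. *)
Lemma H10_with0 (v : X -> R) g : H10_with Omega v g ->
  H10_with Omega (fun=> 0) (fun=> 0).
Proof.
move=> H; apply: eq_H10_with (H10_with_lin mO (-1) H H) => x _.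
  by rewrite mulN1r addNr.
by rewrite scaleN1r addNr.
Qed.

Lemma H10_with_sum (q : nat) (c : 'I_q.+1 -> R) (w : 'I_q.+1 -> X -> R) g :
  (forall j, H10_with Omega (w j) (g j)) ->
  H10_with Omega (fun x => \sum_j c j * w j x) (fun x => \sum_j c j *: g j x).
Proof.
move=> H; have H0 := H10_with0 (H ord0).
have : H10_with Omega (fun x => \sum_(j <- index_enum 'I_q.+1) c j * w j x)
  (fun x => \sum_(j <- index_enum 'I_q.+1) c j *: g j x).
  elim: (index_enum _) => [|j s IH].
    by apply: eq_H10_with H0 => x _; rewrite big_nil.
  by apply: eq_H10_with (H10_with_lin mO (c j) (H j) IH) => x _; rewrite big_cons.
by [].
Qed.

End H10_sums.

(** * Piecewise polynomials in time *)

Section piecewise.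
Context {R : realType} (d q : nat) (Omega : set 'rV[R]_d) (mO : measurable Omega).
Variables (T : R) (N : nat) (t : nat -> R).
Hypothesis tp : time_partition T N t.
Local Notation X := 'rV[R]_d.
Local Notation XT := ('rV[R]_d * measurableTypeR R)%type.
Local Notation mu := (lebesgue_rV d).
Local Notation muT := (@st_measure R d).
Local Notation leb := (@lebesgue_measure R).
Local Notation QT := (slab Omega 0 T).
Local Notation Qn n := (slab Omega (t n) (t n.+1)).

Lemma tp_lt n : (n < N)%N -> t n < t n.+1.
Proof. by case: tp => _ _; exact. Qed.

Lemma tp_le m n : (m <= n <= N)%N -> t m <= t n.
Proof.
move=> /andP[]; elim: n => [|n IH]; first by rewrite leqn0 => /eqP ->.
rewrite leq_eqVlt => /orP[/eqP ->//|]; rewrite ltnS => mn nN.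
by rewrite (le_trans (IH mn (ltnW nN)))// ltW// tp_lt.
Qed.

Lemma tp_ge0 n : (n <= N)%N -> 0 <= t n.
Proof. by move=> nN; case: tp => <- _ _; apply: tp_le. Qed.

Lemma tp_leT n : (n <= N)%N -> t n <= T.
Proof. by move=> nN; case: tp => _ <- _; apply: tp_le; rewrite nN leqnn. Qed.

Lemma tp_inj m n s : (m < N)%N -> (n < N)%N ->
  t m < s < t m.+1 -> t n < s < t n.+1 -> m = n.
Proof.
move=> mN nN /andP[m1 m2] /andP[n1 n2]; apply/eqP; rewrite eqn_leq.
apply/andP; split; rewrite leqNgt; apply/negP => H.
  have := @tp_le n.+1 m; rewrite H (ltnW mN) => /(_ isT).
  by rewrite leNgt (lt_trans m1 n2).
have := @tp_le m.+1 n; rewrite H (ltnW nN) => /(_ isT).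
by rewrite leNgt (lt_trans n1 m2).
Qed.

Lemma slab_sub n : (n < N)%N -> Qn n `<=` QT.
Proof.
move=> nN [x s] [/= Ox]; rewrite !in_itv /= => /andP[s1 s2]; split=> //=.
rewrite in_itv /= (le_lt_trans (tp_ge0 (ltnW nN)) s1).
exact: lt_le_trans s2 (tp_leT nN).
Qed.

Definition nodes : set R := \bigcup_(n in `I_N.+1) [set t n].

Lemma nodes_null : leb nodes = 0%E.
Proof.
apply: countable_lebesgue_measure0; apply: finite_set_countable.
by apply: bigcup_finite => // n _; exact: finite_set1.
Qed.

Lemma measurable_nodes : measurable (nodes : set (measurableTypeR R)).
Proof.
by apply: fin_bigcup_measurable => // n _; exact: measurable_set1.
Qed.

Lemma tp_cover s : 0 < s < T -> ~ nodes s ->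
  exists2 n, (n < N)%N & t n < s < t n.+1.
Proof.
move=> /andP[s0 sT] ns.
have H n : (n <= N)%N -> s < t n -> exists2 m, (m < N)%N & t m < s < t m.+1.
  elim: n => [_|n IH nN sn].
    by case: tp => -> _ _ s0'; move: (lt_trans s0 s0'); rewrite ltxx.
  have [nlt|sle|e] := ltgtP (t n) s.
  - by exists n => //; rewrite nlt.
  - by apply: IH => //; exact: ltnW.
  - by exfalso; apply: ns; exists n => //=; rewrite ltnS ltnW.
by apply: (H N) => //; case: tp => _ ->.
Qed.

(** At most one summand is nonzero, and all of them vanish at the nodes. *)
Definition pw (w : nat -> 'I_q.+1 -> X -> R) (z : XT) : R :=
  \sum_(n < N) if t n < z.2 < t n.+1 then tpoly (t n) (t n.+1) (w n) z else 0.

Lemma pwE w n x s : (n < N)%N -> t n < s < t n.+1 ->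
  pw w (x, s) = tpoly (t n) (t n.+1) (w n) (x, s).
Proof.
move=> nN sn; rewrite /pw (bigD1 (Ordinal nN))//= sn big1 ?addr0// => m mn.
case: ifPn => // sm; have := tp_inj (ltn_ord m) nN sm sn => E.
by move: mn; rewrite -val_eqE /= E eqxx.
Qed.

Lemma L2_pw w : (forall n j, (n < N)%N -> L2 mu Omega (w n j)) -> L2 muT QT (pw w).
Proof.
move=> Lw; apply: (L2_sum (measurable_slab mO 0 T)) => n.
apply: (L2_extend (measurable_slab mO _ _) (measurable_slab mO (t n) (t n.+1)) _ _ _
  (L2_tpoly mO (tp_lt (ltn_ord n)) (fun j => Lw n j (ltn_ord n)))).
- by apply: slab_sub.
- by move=> [x s] [/= _]; rewrite in_itv /= => ->.
- move=> [x s] [/= Ox _] nQ; case: ifPn => // sn; exfalso; apply: nQ; split=> //=.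
Qed.

Definition pwg (g : nat -> 'I_q.+1 -> X -> 'rV[R]_d) (z : XT) : 'rV[R]_d :=
  \row_i pw (fun n j x => g n j x 0 i) z.

Definition pw_rep (u : XT -> R) (w : nat -> 'I_q.+1 -> X -> R) : Prop :=
  forall n, (n < N)%N -> forall x s, Omega x -> t n < s < t n.+1 ->
    u (x, s) = tpoly (t n) (t n.+1) (w n) (x, s).

Lemma L2v_pwg g : (forall n j, (n < N)%N -> L2v mu Omega (g n j)) ->
  L2v muT QT (pwg g).
Proof.
move=> Lg i.
apply: (@eq_L2 _ _ _ _ _ (pw (fun n j x => g n j x 0 i))).
  by move=> z _; rewrite mxE.
by apply: L2_pw => n j nN; exact: (Lg n j nN i).
Qed.

(** Off the nodes, the slice at time [s] is a linear combination of the coefficient functions with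
    constant weights, so it has the same combination of their gradients. The nodes are a null set of
    times. *)
Lemma L2H10_pw u w g : measurable_fun QT u -> pw_rep u w ->
  (forall n j, (n < N)%N -> H10_with Omega (w n j) (g n j)) ->
  L2H10_with Omega T u (pwg g).
Proof.
move=> mU uw H.
have Lw n j : (n < N)%N -> L2 mu Omega (w n j) by move=> /(H n j) [[]].
have Lg n j : (n < N)%N -> L2v mu Omega (g n j) by move=> /(H n j) [[]].
split; [|exact: L2v_pwg|].
  apply: (@L2_ae _ _ _ muT QT (Omega `*` nodes) (pw w)) => //.
  - exact: measurable_slab.
  - by apply: measurableX => //; exact: measurable_nodes.
  - transitivity ((mu \x leb)%E (Omega `*` nodes)); first by [].
    rewrite product_measure1E//; last exact: measurable_nodes.
    by rewrite [X in (_ * X)%E]nodes_null mule0.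
  - move=> [x s] [/= Ox]; rewrite in_itv /= => sT nn.
    have [n nN sn] : exists2 n, (n < N)%N & t n < s < t n.+1.
      by apply: tp_cover => // ns; exact: nn.
    by rewrite (uw n nN)// (pwE _ _ nN sn).
  - exact: L2_pw.
exists nodes; split; [exact: measurable_nodes|exact: nodes_null|].
move=> s /= /not_implyP[s0T nH]; apply: contrapT => ns; apply: nH.
have [n nN sn] := tp_cover s0T ns.
apply: eq_H10_with (H10_with_sum mO (fun j : 'I_q.+1 => sg (t n) (t n.+1) s ^+ j)
  (fun j => H n j nN)) => x Ox.
  by rewrite /slice (uw n nN).
apply/rowP => i; rewrite /slice mxE (pwE _ _ nN sn) /tpoly summxE.
by apply: eq_bigr => j _; rewrite mxE.
Qed.

End piecewise.

(** * Uniqueness of the gradient *)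

Section gradx_unique.
Context {R : realType} (d : nat) (Omega : set 'rV[R]_d) (mO : measurable Omega) (T : R).
Local Notation XT := ('rV[R]_d * measurableTypeR R)%type.
Local Notation mu := (lebesgue_rV d).
Local Notation muT := (@st_measure R d).
Local Notation leb := (@lebesgue_measure R).
Local Notation QT := (slab Omega 0 T).

Lemma L2H10_gradx u G : L2H10_with Omega T u G -> L2H10_with Omega T u (gradx Omega T u).
Proof.
by move=> H; apply: (@xgetPex _ (fun=> 0) [set G | L2H10_with Omega T u G]); exists G.
Qed.

(** At almost every time both slices are gradients of the same function, so the inner integral over
    space vanishes there; Tonelli concludes. *)
Lemma L2H10_grad_unique u G G' : L2H10_with Omega T u G -> L2H10_with Omega T u G' ->
  forall i, L2ip muT QT (fun z => G z 0 i - G' z 0 i) (fun z => G z 0 i - G' z 0 i) = 0.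
Proof.
move=> [_ LG aG] [_ LG' aG'] i.
have mQ := measurable_slab mO 0 T.
have LD := L2_B mQ (LG i) (LG' i).
set D := fun z => _ in LD *; have [mD _] := LD.
have mI : measurable (`]0, T[%classic : set (measurableTypeR R)) by exact: measurable_itv.
apply: EFin_inj; rewrite -(L2norm_ip mQ LD) L2norm_sqr.
have mD2 : measurable_fun QT (fun z => (D z ^+ 2)%:E).
  by apply/measurable_EFinP; exact: measurable_funX.
have D0 z : QT z -> (0 <= (D z ^+ 2)%:E)%E by rewrite lee_fin sqr_ge0.
rewrite (tonelliX mu _ mO mI mD2 D0).
have mi := measurable_integralX mu mO mI mD2 D0.
rewrite (@ge0_ae_eq_integral _ _ _ leb _ _ (cst 0%E) _ mi) ?integral0//.
  by move=> s _; apply: integral_ge0 => x _; rewrite lee_fin sqr_ge0.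
apply: negligibleS (negligibleU aG aG') => s /= nE.
apply: contrapT => /not_orP[/contrapT Hs /contrapT Hs']; apply: nE.
rewrite in_itv /= => sT; have HG := Hs sT; have HG' := Hs' sT.
have := H10_grad_unique mO HG HG' i; rewrite /slice => E0.
have [[_ Lgs _] _] := HG; have [[_ Lgs' _] _] := HG'.
have := L2norm_ip mO (L2_B mO (Lgs i) (Lgs' i)); rewrite L2norm_sqr => ->.
by rewrite E0.
Qed.

(** Replaces the chosen gradient by any explicit one under the inner product, in practice by the
    piecewise gradient [pwg]. *)
Lemma L2vip_gradx u G (H : XT -> 'rV[R]_d) : L2H10_with Omega T u G ->
  L2v muT QT H -> L2vip muT QT (gradx Omega T u) H = L2vip muT QT G H.
Proof.
move=> HG LH; have HG' := L2H10_gradx HG.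
apply: eq_bigr => i _; apply: (L2ip_null (measurable_slab mO 0 T)) => //.
- by case: HG' => _ + _; exact.
- by case: HG => _ + _; exact.
- exact: (L2H10_grad_unique HG' HG).
Qed.

Lemma L2vnorm2_ip (F : XT -> 'rV[R]_d) : L2v muT QT F ->
  (L2vnorm2 muT QT F = (L2vip muT QT F F)%:E)%E.
Proof.
move=> LF; rewrite /L2vnorm2 /L2vip -sumEFin; apply: eq_bigr => i _.
exact: (L2norm_ip (measurable_slab mO 0 T) (LF i)).
Qed.

Lemma L2vipC (F G : XT -> 'rV[R]_d) : L2vip muT QT F G = L2vip muT QT G F.
Proof. by apply: eq_bigr => i _; exact: L2ipC. Qed.

End gradx_unique.

(** * The discrete space and the identity on one slab *)

Section finite_elements.
Context {R : realType} (d q p : nat) (Omega : set 'rV[R]_d) (mO : measurable Omega).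
Variable Th : seq 'M[R]_(d.+1, d).
Local Notation X := 'rV[R]_d.

Lemma Vh_lin (a : R) (v w : X -> R) : Vh Omega Th p v -> Vh Omega Th p w ->
  Vh Omega Th p (fun x => a * v x + w x).
Proof.
move=> [[g Hg] pv] [[h Hh] pw]; split.
  by exists (fun x => a *: g x + h x); exact: H10_with_lin.
move=> K KT; have [P [c cP] aP] := pv K KT; have [P' [c' cP'] aP'] := pw K KT.
exists (fun x => a * P x + P' x).
  exists (fun m => a * c m + c' m) => x; rewrite cP cP' mulr_sumr -big_split /=.
  by apply: eq_bigr => m _; rewrite mulrDl mulrA.
apply: negligibleS (negligibleU aP aP') => x /= nE.
apply: contrapT => /not_orP[/contrapT Hx /contrapT Hx']; apply: nE => Kx.
by rewrite Hx// Hx'.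
Qed.

Lemma Vh0 (v : X -> R) : Vh Omega Th p v -> Vh Omega Th p (fun=> 0).
Proof.
move=> H; have := Vh_lin (-1) H H; congr (Vh Omega Th p _).
by apply/funext => x; rewrite mulN1r addNr.
Qed.

Lemma Vh_sum (c : 'I_q.+1 -> R) (w : 'I_q.+1 -> X -> R) :
  (forall j, Vh Omega Th p (w j)) -> Vh Omega Th p (fun x => \sum_j c j * w j x).
Proof.
move=> H; have H0 := Vh0 (H ord0).
have : Vh Omega Th p (fun x => \sum_(j <- index_enum 'I_q.+1) c j * w j x).
  elim: (index_enum _) => [|j s IH].
    by move: H0; congr (Vh Omega Th p _); apply/funext => x; rewrite big_nil.
  move: (Vh_lin (c j) (H j) IH); congr (Vh Omega Th p _).
  by apply/funext => x; rewrite big_cons.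
by [].
Qed.

End finite_elements.

(** The binomial coefficients vanish for [j > k], so the expansion can run over all degrees up to
    [q]. It serves both directions of the change between monomials in time and in rescaled time. *)
Lemma affine_powers (R : realType) (q : nat) (al be : R) :
  exists c : 'M[R]_q.+1, forall (k : 'I_q.+1) s,
    (be + al * s) ^+ k = \sum_j c k j * s ^+ j.
Proof.
exists (\matrix_(k, j) (be ^+ (k - j) * al ^+ j *+ 'C(k, j))) => k s.
rewrite exprDn (big_ord_widen _ (fun i => be ^+ (k - i) * (al * s) ^+ i *+ 'C(k, i)) (ltn_ord k)).
rewrite [RHS](bigID (fun j : 'I_q.+1 => (j < k.+1)%N)) /= [X in _ = _ + X]big1 ?addr0.
  by apply: eq_bigr => j _; rewrite mxE exprMn mulrA mulrnAl.
move=> j; rewrite -leqNgt => kj; rewrite mxE bin_small ?mulr0n ?mul0r//.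
Qed.

(** * Discrete functions as piecewise polynomials, and those living on one slab *)

Section discrete_space.
Context {R : realType} (d q p : nat) (Omega : set 'rV[R]_d) (mO : measurable Omega).
Variables (T : R) (N : nat) (t : nat -> R) (Th : seq 'M[R]_(d.+1, d)).
Hypothesis tp : time_partition T N t.
Local Notation X := 'rV[R]_d.
Local Notation XT := ('rV[R]_d * measurableTypeR R)%type.
Local Notation mu := (lebesgue_rV d).
Local Notation QT := (slab Omega 0 T).

Lemma Vht_pw_rep u : Vht Omega T N t Th p q u ->
  exists w : nat -> 'I_q.+1 -> X -> R,
    (forall n j, (n < N)%N -> Vh Omega Th p (w n j)) /\ pw_rep Omega N t u w.
Proof.
move=> [_ H].
have C n : exists w : 'I_q.+1 -> X -> R, (n < N)%N ->
    (forall j, Vh Omega Th p (w j)) /\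
    forall x s, Omega x -> t n < s < t n.+1 -> u (x, s) = tpoly (t n) (t n.+1) w (x, s).
  have [nN|nN] := boolP (n < N)%N; last first.
    (* Arbitrary beyond the last slab: the choice of coefficients is made for every [n]. *)
    by exists (fun _ _ => 0).
  have [v Vv uv] := H n nN.
  have [c cE] := affine_powers q (t n.+1 - t n) (t n).
  exists (fun k x => \sum_j c j k * v j x) => _; split.
    by move=> j; exact: (Vh_sum mO (fun i => c i j) Vv).
  move=> x s Ox sn; rewrite uv// /tpoly /=.
  have sE : t n + (t n.+1 - t n) * sg (t n) (t n.+1) s = s.
    rewrite /sg mulrC divfK ?subrKC//.
    by rewrite gt_eqF// subr_gt0 (tp_lt tp).
  under eq_bigr => j _ do rewrite -{1}sE cE mulr_suml.
  rewrite exchange_big /=; apply: eq_bigr => k _.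
  by rewrite mulr_sumr; apply: eq_bigr => j _; rewrite mulrAC mulrC.
have [w Hw] := choice C.
exists w; split; first by move=> n j nN; have [] := Hw n nN.
by move=> n nN; have [_] := Hw n nN.
Qed.

Lemma Vh_L2 v : Vh Omega Th p v -> L2 mu Omega v.
Proof. by move=> [[g [[]]]]. Qed.

Lemma pw_Vht (w : nat -> 'I_q.+1 -> X -> R) :
  (forall n j, (n < N)%N -> Vh Omega Th p (w n j)) ->
  Vht Omega T N t Th p q (pw N t w).
Proof.
move=> Hw; split.
  have [] // := L2_pw mO tp (w := w).
  by move=> n j nN; apply: Vh_L2; exact: Hw.
move=> n nN.
have [c cE] := affine_powers q (t n.+1 - t n)^-1 (- t n / (t n.+1 - t n)).
exists (fun k x => \sum_j c j k * w n j x).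
  by move=> j; apply: (Vh_sum mO (fun i => c i j)) => i; exact: Hw.
move=> x s Ox sn; rewrite (pwE tp _ _ nN sn) /tpoly /=.
have sE : sg (t n) (t n.+1) s = - t n / (t n.+1 - t n) + (t n.+1 - t n)^-1 * s.
  by rewrite /sg mulrBl addrC mulNr; congr (_ + _); rewrite mulrC.
under eq_bigr => j _ do rewrite sE cE mulr_suml.
rewrite exchange_big /=; apply: eq_bigr => k _.
by rewrite mulr_sumr; apply: eq_bigr => j _; rewrite mulrAC mulrC.
Qed.

Lemma pw_rep_pw (w : nat -> 'I_q.+1 -> X -> R) : pw_rep Omega N t (pw N t w) w.
Proof. by move=> n nN x s _ sn; exact: (pwE tp). Qed.

(** Coefficients of a test function supported on slab [n]. The default [y0] is the zero of [Y], a
    parameter because both values and gradients are localized this way. *)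
Definition single {Y : Type} (y0 : Y) (n : nat) (z : 'I_q.+1 -> X -> Y) (m : nat) :
  'I_q.+1 -> X -> Y := if m == n then z else fun _ _ => y0.

Lemma tpoly0 a b (y : XT) : tpoly a b (fun (_ : 'I_q.+1) (_ : X) => 0) y = 0 :> R.
Proof. by rewrite /tpoly big1// => j _; rewrite mulr0. Qed.

Lemma pw_single_in n z x s : (n < N)%N -> t n < s < t n.+1 ->
  pw N t (single 0 n z) (x, s) = tpoly (t n) (t n.+1) z (x, s).
Proof. by move=> nN sn; rewrite (pwE tp _ _ nN sn) /single eqxx. Qed.

Lemma pw_single_out n z x s : ~ (t n < s < t n.+1) -> pw N t (single 0 n z) (x, s) = 0.
Proof.
move=> sn; rewrite /pw big1// => m _; case: ifPn => //= sm.
by rewrite /single; case: eqP => [mn|_]; [rewrite mn in sm|exact: tpoly0].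
Qed.

Lemma pw_single_other n m z x s : (m < N)%N -> m != n -> t m < s < t m.+1 ->
  pw N t (single 0 n z) (x, s) = 0.
Proof.
by move=> mN mn sm; rewrite (pwE tp _ _ mN sm) /single (negbTE mn) tpoly0.
Qed.

Lemma pwg_single n h y i : pwg N t (single 0 n h) y 0 i =
  pw N t (single 0 n (fun j x => h j x 0 i)) y.
Proof.
rewrite mxE; congr (pw N t _ y); apply/funext => m; apply/funext => j; apply/funext => x.
by rewrite /single; case: eqP => // _; rewrite mxE.
Qed.

End discrete_space.

(** Here [b], [c] and [o] are the jump sum, the initial trace term and the datum term of the scheme;
    they are traded for [k - l], which involves slab [n] and its incoming trace only. *)
Lemma trace_balance (R : realType) (a b c e k l m o r : R) : b + c - o = k - l ->
  a + b + c + e = m + r + o -> a + k - l + e = m + r.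
Proof. by lra. Qed.

(** * Reduction of the scheme to one slab *)

Section local_identity.
Context {R : realType} (d q p : nat) (Omega : set 'rV[R]_d) (mO : measurable Omega).
Variables (T nu : R) (N : nat) (t : nat -> R) (Th : seq 'M[R]_(d.+1, d)).
Hypothesis tp : time_partition T N t.
Local Notation X := 'rV[R]_d.
Local Notation XT := ('rV[R]_d * measurableTypeR R)%type.
Local Notation mu := (lebesgue_rV d).
Local Notation muT := (@st_measure R d).
Local Notation QT := (slab Omega 0 T).
Local Notation Qn n := (slab Omega (t n) (t n.+1)).
Variables (f Y u : XT -> R) (u0 : X -> R).
Variables (w : nat -> 'I_q.+1 -> X -> R) (g : nat -> 'I_q.+1 -> X -> 'rV[R]_d).
Hypotheses (mu_u : measurable_fun QT u) (uw : pw_rep Omega N t u w).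
Hypothesis wg : forall n j, (n < N)%N -> H10_with Omega (w n j) (g n j).
Hypotheses (LY : L2v muT QT (gradx Omega T Y)) (Lu0 : L2 mu Omega u0).
Hypothesis Beq : forall v, Vht Omega T N t Th p q v ->
  Bht Omega T N t nu u v =
    L2ip muT QT f v + nu * L2vip muT QT (gradx Omega T Y) (gradx Omega T v)
    + L2ip mu Omega u0 (trace_right v 0).

Let Lw n j : (n < N)%N -> L2 mu Omega (w n j).
Proof. by move=> /(wg j) [[]]. Qed.

Definition incoming n : X -> R :=
  if n is m.+1 then fun x => \sum_j w m j x else u0.

Lemma L2_incoming n : (n <= N)%N -> L2 mu Omega (incoming n).
Proof. by case: n => [//|n] nN /=; apply: (L2_sum mO) => j; exact: Lw. Qed.

Lemma trace_right_rep v z n x : pw_rep Omega N t v z -> (n < N)%N -> Omega x ->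
  trace_right v (t n) x = z n (ord0 : 'I_q.+1) x.
Proof.
by move=> vz nN Ox; apply: (trace_right_tpoly (tp_lt tp nN)) => s sn; exact: vz.
Qed.

Lemma trace_left_rep v z n x : pw_rep Omega N t v z -> (n < N)%N -> Omega x ->
  trace_left v (t n.+1) x = \sum_(j < q.+1) z n j x.
Proof.
by move=> vz nN Ox; apply: (trace_left_tpoly (tp_lt tp nN)) => s sn; exact: vz.
Qed.

Lemma jump_rep n x : (n.+1 < N)%N -> Omega x ->
  jump u (t n.+1) x = w n.+1 ord0 x - incoming n.+1 x.
Proof.
move=> nN Ox; rewrite /jump /= (trace_right_rep uw nN Ox).
by rewrite (trace_left_rep uw (ltnW nN) Ox).
Qed.

Section test.
Variables (n : nat) (nN : (n < N)%N) (z : 'I_q.+1 -> X -> R) (h : 'I_q.+1 -> X -> 'rV[R]_d).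
Hypotheses (Vz : forall j, Vh Omega Th p (z j)) (zh : forall j, H10_with Omega (z j) (h j)).
Let v := pw N t (single 0 n z).
Let Lz j : L2 mu Omega (z j). Proof. by have [[]] := zh j. Qed.
Let Lh j : L2v mu Omega (h j). Proof. by have [[]] := zh j. Qed.
Let Lhi i j : L2 mu Omega (fun x => h j x 0 i). Proof. exact: Lh. Qed.
Let Lgi i j : L2 mu Omega (fun x => g n j x 0 i).
Proof. by have [[_ Lg _] _] := wg j nN; exact: Lg. Qed.

Let Vv : Vht Omega T N t Th p q v.
Proof.
apply: (pw_Vht mO tp) => m j mN; rewrite /single; case: eqP => // _.
exact: (Vh0 mO (Vz ord0)).
Qed.

Let Hv : L2H10_with Omega T v (pwg N t (single 0 n h)).
Proof.
apply: (L2H10_pw mO tp _ (pw_rep_pw tp (single 0 n z))); first by case: Vv.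
move=> m j mN; rewrite /single; case: eqP => // _; exact: (H10_with0 mO (zh ord0)).
Qed.

Let Hu : L2H10_with Omega T u (pwg N t g).
Proof. exact: (L2H10_pw mO tp mu_u uw). Qed.

Lemma L2ip_single (F : XT -> R) (k : 'I_q.+1 -> X -> R) :
  L2ip muT QT F (pw N t (single 0 n k)) = L2ip muT (Qn n) F (tpoly (t n) (t n.+1) k).
Proof.
rewrite L2ipC [RHS]L2ipC.
apply: (L2ip_extend _ (slab_sub tp nN)).
- by move=> [x s] [/= _]; rewrite in_itv /=; exact: (pw_single_in tp).
- move=> [x s] [/= Ox _] nQ; apply: pw_single_out => sn; apply: nQ; split=> //=.
Qed.

Lemma test_dt :
  \sum_(0 <= m < N) L2ip muT (Qn m) (dt u) v =
  L2ip muT (Qn n) (dtpoly (t n) (t n.+1) (w n)) (tpoly (t n) (t n.+1) z).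
Proof.
rewrite big_mkord (bigD1 (Ordinal nN))//= [X in _ + X]big1 ?addr0; last first.
  move=> m mn; rewrite -[RHS](L2ip0r muT (measurable_slab mO (t m) (t m.+1)) (dt u)).
  apply: eq_L2ip => // -[x s] [/= _]; rewrite in_itv /= => sm.
  exact: (pw_single_other tp _ _ (ltn_ord m)).
apply: eq_L2ip => -[x s] [/= Ox]; rewrite in_itv /= => sn.
  by apply: dt_tpoly => // r rn; exact: uw.
exact: (pw_single_in tp).
Qed.

Lemma trace_v m x : (m < N)%N -> Omega x ->
  trace_right v (t m) x = single 0 n z m ord0 x.
Proof. by move=> mN Ox; apply: (trace_right_rep (pw_rep_pw tp (single 0 n z))). Qed.

(** Jumps are paired with right traces of the test function, so a function living on slab [n] sees
    the node [t n] and not [t n.+1]. Counting [u0] as the trace incoming at time 0 gives the first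
    slab the same identity as the others. *)
Lemma test_traces :
  \sum_(1 <= m < N) L2ip mu Omega (jump u (t m)) (trace_right v (t m))
  + L2ip mu Omega (trace_right u 0) (trace_right v 0)
  - L2ip mu Omega u0 (trace_right v 0) =
  L2ip mu Omega (w n ord0) (z ord0) - L2ip mu Omega (incoming n) (z ord0).
Proof.
have N0 : (0 < N)%N by exact: leq_ltn_trans nN.
have t0 : t 0%N = 0 by case: tp.
have off m (F : X -> R) : (m < N)%N -> m != n ->
    L2ip mu Omega F (trace_right v (t m)) = 0.
  move=> mN mn; rewrite -[RHS](L2ip0r mu mO F); apply: eq_L2ip => // x Ox.
  by rewrite trace_v// /single (negbTE mn).
have on (F F' : X -> R) : (forall x, Omega x -> F x = F' x) ->
    L2ip mu Omega F (trace_right v (t n)) = L2ip mu Omega F' (z ord0).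
  by move=> FF; apply: eq_L2ip => // x Ox; rewrite trace_v// /single eqxx.
have -> : trace_right u 0 = trace_right u (t 0%N) by rewrite t0.
have -> : trace_right v 0 = trace_right v (t 0%N) by rewrite t0.
case: (n) nN off on => [|k] kN off on.
  rewrite big_nat big1 ?add0r => [|m /andP[m1 mN]]; last first.
    by apply: off => //; rewrite -lt0n.
  rewrite (on _ (w 0%N ord0)) ?(on _ u0)// => x Ox.
  exact: (trace_right_rep uw kN Ox).
rewrite (off 0%N)// (off 0%N)// subr0 addr0.
rewrite (@big_cat_nat _ _ _ k.+1) //=; last exact: ltnW.
rewrite [X in X + _]big_nat big1 ?add0r => [|m /andP[m1 mk]]; last first.
  by apply: off; [exact: ltn_trans kN|rewrite ltn_eqF].
rewrite big_ltn// [X in _ + X]big_nat [X in _ + X]big1 ?addr0 => [|m /andP[mk mN]]; last first.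
  by apply: off => //; rewrite gtn_eqF.
rewrite (on _ (fun x => w k.+1 ord0 x - incoming k.+1 x)); last first.
  by move=> x Ox; exact: jump_rep.
rewrite L2ipBl//; [exact: Lw|exact: L2_incoming (ltnW kN)].
Qed.

(** The left side is expressed entirely by coefficient functions. The step length multiplies the
    viscous form but not the time-derivative form, which is why the latter has constants depending
    on [q] alone. *)
Lemma local_identity :
  L2form mu Omega (dg_mx q) (w n) z - L2ip mu Omega (incoming n) (z ord0)
  + nu * \sum_i (t n.+1 - t n) *
      L2form mu Omega (hilbert_mx q) (fun j x => g n j x 0 i) (fun j x => h j x 0 i) =
  L2ip muT (Qn n) f (tpoly (t n) (t n.+1) z)
  + nu * \sum_i L2ip muT (Qn n) (fun y => gradx Omega T Y y 0 i)
      (tpoly (t n) (t n.+1) (fun j x => h j x 0 i)).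
Proof.
have LG : L2v muT QT (pwg N t g) by case: Hu.
have LH : L2v muT QT (pwg N t (single 0 n h)) by case: Hv.
have Lgv : L2v muT QT (gradx Omega T v) by case: (L2H10_gradx Hv).
have E1 : L2vip muT QT (gradx Omega T u) (gradx Omega T v) =
    \sum_i (t n.+1 - t n) *
      L2form mu Omega (hilbert_mx q) (fun j x => g n j x 0 i) (fun j x => h j x 0 i).
  rewrite (L2vip_gradx mO Hu Lgv) L2vipC (L2vip_gradx mO Hv LG) L2vipC.
  apply: eq_bigr => i _; rewrite -(L2ip_tpoly mO (tp_lt tp nN) (Lgi i) (Lhi i)).
  transitivity (L2ip muT QT (fun y => pwg N t g y 0 i)
      (pw N t (single 0 n (fun j x => h j x 0 i)))).
    by apply: eq_L2ip => // y _; exact: pwg_single.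
  rewrite L2ip_single.
  apply: eq_L2ip => // -[x s] [/= Ox]; rewrite in_itv /= => sn.
  by rewrite mxE (pwE tp _ _ nN sn).
have E2 : L2vip muT QT (gradx Omega T Y) (gradx Omega T v) =
    \sum_i L2ip muT (Qn n) (fun y => gradx Omega T Y y 0 i)
      (tpoly (t n) (t n.+1) (fun j x => h j x 0 i)).
  rewrite L2vipC (L2vip_gradx mO Hv LY) L2vipC; apply: eq_bigr => i _.
  rewrite -L2ip_single; apply: eq_L2ip => // y _; exact: pwg_single.
have := Beq Vv; rewrite /Bht test_dt E1 E2 L2ip_single.
rewrite -(L2ip_dtpoly mO (tp_lt tp nN) (fun j => Lw j nN) Lz).
have := test_traces.
exact: trace_balance.
Qed.

End test.

End local_identity.

(** * Constants depending on the degree, and a discrete Gronwall bound *)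

Section form_constants.
Context {R : realType} (q : nat).
Implicit Types (L : 'M[R]_q.+1) (c : 'I_q.+1 -> R).

Definition mxlift L c : 'I_q.+1 -> R := fun k => \sum_l L k l * c l.

Lemma sqr_sum_le (K Q : R) (F : 'I_q.+1 -> R) : 0 <= K * Q ->
  (forall j, F j ^+ 2 <= K * Q) -> (\sum_j F j) ^+ 2 <= q.+1%:R ^+ 2 * (K * Q).
Proof.
move=> KQ FK; have r0 := sqrtr_ge0 (K * Q).
have Fr j : `|F j| <= Num.sqrt (K * Q) by rewrite -sqrtr_sqr ler_wsqrtr.
have : `|\sum_j F j| <= q.+1%:R * Num.sqrt (K * Q).
  rewrite (le_trans (ler_norm_sum _ _ _))// (le_trans (ler_sum _ (fun j _ => Fr j)))//.
  by rewrite sumr_const card_ord mulr_natl.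
rewrite -(@ler_pXn2r _ 2)// ?nnegrE ?mulr_ge0//.
by rewrite real_normK ?num_real// exprMn sqr_sqrtr.
Qed.

Lemma quadf_hilbert_le (B : R) c : (forall j, c j ^+ 2 <= B) ->
  quadf (hilbert_mx q) c <= q.+1%:R ^+ 2 * B.
Proof.
move=> cB; have B0 : 0 <= B := le_trans (sqr_ge0 _) (cB ord0).
rewrite (@le_trans _ _ (\sum_(j < q.+1) \sum_(k < q.+1) B))//; last first.
  by rewrite !sumr_const !card_ord -mulrnA -[leLHS]mulr_natl natrM -expr2.
apply: ler_sum => j _; apply: ler_sum => k _; rewrite mxE.
rewrite (le_trans (ler_norm _))// normrM -[leRHS]mul1r ler_pM//.
  by rewrite ger0_norm ?invr_ge0// invf_le1 ?ltr0n// ler1n.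
have := cB j; have := cB k; rewrite normrM.
rewrite -(real_normK (num_real (c j))) -(real_normK (num_real (c k))).
have := sqr_ge0 (`|c j| - `|c k|); nra.
Qed.

Lemma quadf_constants : exists L, exists2 K : R, 1 <= K & dg_mx q *m L = hilbert_mx q /\
  forall c, [/\ forall j, c j ^+ 2 <= K * quadf (hilbert_mx q) c,
    forall k, mxlift L c k ^+ 2 <= K * quadf (hilbert_mx q) c,
    quadf (hilbert_mx q) (mxlift L c) <= K * quadf (hilbert_mx q) c &
    forall r, 0 <= r <= 1 -> (\sum_(j < q.+1) r ^+ j * c j) ^+ 2 <= K * quadf (hilbert_mx q) c].
Proof.
have [L LE] := @dg_lift R q; exists L; have [K0 K00 HK0] := @hilbert_form_coef R q.
(* The squared Frobenius norm of [L], which dominates the square of each entry. *)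
pose ell := \sum_k \sum_l L k l ^+ 2.
have ell0 : 0 <= ell by apply: sumr_ge0 => k _; apply: sumr_ge0 => l _; exact: sqr_ge0.
pose n2 : R := q.+1%:R ^+ 2.
have n1 : 1 <= n2 by rewrite expr_ge1// ler1n.
(* [K1] bounds the coefficients of the lifted polynomial, [K2] its mean square, and [K3] the point
   values of the original one. *)
pose K1 := n2 * (ell * K0); pose K2 := n2 * K1; pose K3 := n2 * K0.
have n0 : 0 <= n2 by rewrite (le_trans ler01).
have K10 : 0 <= K1 by rewrite !mulr_ge0.
have K20 : 0 <= K2 by rewrite mulr_ge0.
have K30 : 0 <= K3 by rewrite mulr_ge0.
(* The sum dominates each constant at once; the [1] secures [1 <= K]. *)
exists (1 + K0 + K1 + K2 + K3); first by rewrite -!addrA lerDl !addr_ge0.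
split=> // c; set Q := quadf _ c; have Q0 : 0 <= Q := hilbert_form_ge0 c.
have up x k : x <= k * Q -> k <= 1 + K0 + K1 + K2 + K3 -> x <= (1 + K0 + K1 + K2 + K3) * Q.
  by move=> xk kK; rewrite (le_trans xk)// ler_wpM2r.
have L1 k : mxlift L c k ^+ 2 <= K1 * Q.
  rewrite /K1 -mulrA; apply: sqr_sum_le => [|l]; first by rewrite !mulr_ge0.
  rewrite exprMn -[leRHS]mulrA.
  apply: ler_pM; [exact: sqr_ge0|exact: sqr_ge0| |exact: HK0].
  rewrite /ell (bigD1 k)//= (bigD1 l)//= -addrA lerDl addr_ge0//.
    by apply: sumr_ge0 => i _; exact: sqr_ge0.
  by apply: sumr_ge0 => i _; apply: sumr_ge0 => l' _; exact: sqr_ge0.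
split.
- by move=> j; apply: (up _ _ (HK0 c j)); lra.
- by move=> k; apply: (up _ _ (L1 k)); lra.
- apply: (up _ K2); last by lra.
  by rewrite /K2 -mulrA; exact: quadf_hilbert_le.
- move=> r /andP[r0 r1]; apply: (up _ K3); last by lra.
  rewrite /K3 -mulrA; apply: sqr_sum_le => [|j]; first by rewrite mulr_ge0.
  rewrite exprMn (le_trans _ (HK0 c j))// ler_piMl ?sqr_ge0//.
  by rewrite -exprM exprn_ile1.
Qed.

End form_constants.

(** * Real inequalities behind the numerical constants *)

Section real_bounds.
Context {R : realType}.
Implicit Types (S D Ft M B r F a y : R).

(** For the slab where [m] is largest, with [B] the bound from the summed energy estimates. Young's
    inequality moves a quarter of [M ^+ 2] to the left for each of the two products, and the
    remaining half doubles the constants: $2(1 + 4) = 10$. *)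
Lemma peak_bound0 S B Ft M r F a y : 1 <= S -> 0 <= B -> 0 <= a -> 0 <= y -> 0 <= r ->
  0 <= F -> 0 <= M -> r ^+ 2 <= B -> a <= B -> y <= B -> F <= Ft ->
  M ^+ 2 <= S * (r + F) * M + 2 * S * (a + y) ->
  M ^+ 2 <= 10 * (S ^+ 2 * B) + 2 * (S ^+ 2 * Ft ^+ 2).
Proof.
move=> S1 B0 a0 y0 r0 F0 M0 r2 aB yB FF Ln.
have Y1 : S * r * M <= M ^+ 2 / 4 + S ^+ 2 * r ^+ 2.
  have := sqr_ge0 (M / 2 - S * r); clear; nra.
have Y2 : S * F * M <= M ^+ 2 / 4 + S ^+ 2 * F ^+ 2.
  have := sqr_ge0 (M / 2 - S * F); clear; nra.
have S0 : 0 <= S by rewrite (le_trans ler01).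
have F2 : F ^+ 2 <= Ft ^+ 2 by rewrite ler_pXn2r ?nnegrE// (le_trans F0).
have P1 : S ^+ 2 * r ^+ 2 <= S ^+ 2 * B by rewrite ler_wpM2l// exprn_ge0.
have P2 : S ^+ 2 * F ^+ 2 <= S ^+ 2 * Ft ^+ 2 by rewrite ler_wpM2l// exprn_ge0.
have P3 : S * (a + y) <= S ^+ 2 * (B + B).
  rewrite ler_pM ?addr_ge0//; last exact: lerD.
  by rewrite expr2 ler_peMl.
move: Ln Y1 Y2 P1 P2 P3; clear; lra.
Qed.

(** [B] itself contains [M] linearly. Young's inequality on the term $20 S^3 F_t M$ produces $200
    S^6 F_t^2$, the origin of the sixth power; doubling and adding the remaining $4 S^2 F_t^2$ gives
    404. *)
Lemma peak_bound S D Ft M : 1 <= S -> 0 <= D ->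
  M ^+ 2 <= 10 * (S ^+ 2 * (D + 2 * S * Ft * M)) + 2 * (S ^+ 2 * Ft ^+ 2) ->
  M ^+ 2 <= 404 * S ^+ 6 * (D + Ft ^+ 2).
Proof.
move=> S1 D0 H.
have S26 : S ^+ 2 <= S ^+ 6 by rewrite ler_weXn2l.
have Y3 : 20 * S ^+ 3 * Ft * M <= M ^+ 2 / 2 + 200 * (S ^+ 6 * Ft ^+ 2).
  by have := sqr_ge0 (M - 20 * S ^+ 3 * Ft); clear; nra.
have Q1 : S ^+ 2 * D <= S ^+ 6 * D by rewrite ler_wpM2r.
have Q2 : S ^+ 2 * Ft ^+ 2 <= S ^+ 6 * Ft ^+ 2 by rewrite ler_wpM2r// sqr_ge0.
have Q3 : 0 <= S ^+ 6 * D by rewrite mulr_ge0// exprn_ge0// (le_trans ler01).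
have -> : 404 * S ^+ 6 * (D + Ft ^+ 2) = 404 * (S ^+ 6 * D) + 404 * (S ^+ 6 * Ft ^+ 2).
  by ring.
have E : 10 * (S ^+ 2 * (D + 2 * S * Ft * M)) =
    10 * (S ^+ 2 * D) + 20 * S ^+ 3 * Ft * M by ring.
move: H Y3 Q1 Q2 Q3; rewrite E; clear.
move: (20 * S ^+ 3 * Ft * M) (S ^+ 2 * D) (S ^+ 6 * D) (S ^+ 2 * Ft ^+ 2)
  (S ^+ 6 * Ft ^+ 2) (M ^+ 2) => x1 x2 x3 x4 x5 x6; lra.
Qed.

Lemma total_bound S D Ft M : 1 <= S -> 0 <= D ->
  M ^+ 2 <= 404 * S ^+ 6 * (D + Ft ^+ 2) ->
  D + 2 * S * Ft * M <= 406 * S ^+ 6 * (D + Ft ^+ 2).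
Proof.
move=> S1 D0 H.
have S26 : S ^+ 2 <= S ^+ 6 by rewrite ler_weXn2l.
have Y : 2 * S * Ft * M <= S ^+ 2 * Ft ^+ 2 + M ^+ 2.
  by have := sqr_ge0 (S * Ft - M); clear; nra.
have Q2 : S ^+ 2 * Ft ^+ 2 <= S ^+ 6 * Ft ^+ 2 by rewrite ler_wpM2r// sqr_ge0.
have Q1 : D <= S ^+ 6 * D by rewrite ler_peMl// expr_ge1// (le_trans ler01).
have Q3 : 0 <= S ^+ 6 * Ft ^+ 2.
  by rewrite mulr_ge0 ?sqr_ge0// exprn_ge0// (le_trans ler01).
have E k : k * S ^+ 6 * (D + Ft ^+ 2) = k * (S ^+ 6 * D) + k * (S ^+ 6 * Ft ^+ 2).
  by ring.
move: H Y Q1 Q2 Q3 D0; rewrite !E; clear.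
move: (S ^+ 6 * D) (S ^+ 2 * Ft ^+ 2) (2 * S * Ft * M)
  (S ^+ 6 * Ft ^+ 2) (M ^+ 2) => x1 x2 x3 x4 x5; lra.
Qed.

End real_bounds.

Section discrete_gronwall.
Context {R : realType}.
Variables (S : R) (N : nat) (e j a y F m : nat -> R).
Hypotheses (S1 : 1 <= S) (e0 : forall n, (n <= N)%N -> 0 <= e n).
Hypotheses (j0 : forall n, 0 <= j n) (a0 : forall n, 0 <= a n) (y0 : forall n, 0 <= y n)
  (F0 : forall n, 0 <= F n) (m0 : forall n, 0 <= m n).
Hypothesis energy : forall n, (n < N)%N ->
  e n.+1 - e n + j n + a n <= 2 * S * F n * m n + y n.
Hypothesis lifted : forall n, (n < N)%N ->
  m n ^+ 2 <= S * (Num.sqrt (e n) + F n) * m n + 2 * S * (a n + y n).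

Let D := e 0%N + \sum_(n < N) y n.
Let Ft := \sum_(n < N) F n.

(** The alternative [M = 0] is for an empty range of slabs. *)
Lemma max_attained k : exists M, [/\ 0 <= M, forall n, (n < k)%N -> m n <= M &
  M = 0 \/ exists2 n, (n < k)%N & M = m n].
Proof.
elim: k => [|k [M [M0 HM MM]]]; first by exists 0; split=> //; left.
have [mM|Mm] := leP (m k) M.
  exists M; split=> //.
    by move=> n; rewrite ltnS leq_eqVlt => /orP[/eqP ->//|/HM].
  by case: MM => [|[n nk]]; [left|right; exists n => //; exact: ltnW].
exists (m k); split=> //; last by right; exists k.
move=> n; rewrite ltnS leq_eqVlt => /orP[/eqP ->//|/HM nM].
exact: le_trans nM (ltW Mm).
Qed.

Lemma partial_sum_le (G : nat -> R) n : (forall k, 0 <= G k) -> (n <= N)%N ->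
  \sum_(k < n) G k <= \sum_(k < N) G k.
Proof.
move=> G0 nN; rewrite -!(big_mkord xpredT G) (@big_cat_nat _ _ _ n 0 N)//= lerDl.
by apply: sumr_ge0.
Qed.

Lemma term_le_sum (G : nat -> R) n : (forall k, 0 <= G k) -> (n < N)%N ->
  G n <= \sum_(k < N) G k.
Proof.
move=> G0 nN; rewrite (bigD1 (Ordinal nN))//= lerDl.
by apply: sumr_ge0.
Qed.

Lemma energy_sum M n : (forall n, (n < N)%N -> m n <= M) -> (n <= N)%N ->
  e n + \sum_(k < n) (j k + a k) <= D + 2 * S * Ft * M.
Proof.
move=> HM nN.
suff H : e n + \sum_(k < n) (j k + a k) <=
    e 0%N + \sum_(k < n) y k + 2 * S * (\sum_(k < n) F k) * M.
  (* The sign of [M] can only be read off from some [m k], so an empty sum is treated apart. *)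
  have M0 : 0 <= M \/ n = 0%N.
    by case: (n) nN => [|k] kN; [right|left; exact: le_trans (m0 k) (HM k kN)].
  case: M0 => [M0|n0].
    apply: le_trans H _; apply: lerD; first by rewrite lerD2l partial_sum_le.
    by rewrite ler_wpM2r// ler_wpM2l ?partial_sum_le// mulr_ge0// (le_trans ler01).
  move: H; rewrite n0 !big_ord0 !addr0 mulr0 mul0r addr0 => _.
  rewrite /D -addrA lerDl.
  have [N0|N0] := posnP N.
    by rewrite /Ft N0 !big_ord0 mulr0 mul0r addr0.
  apply: addr_ge0; first exact: sumr_ge0.
  apply: mulr_ge0; last exact: le_trans (m0 0%N) (HM _ N0).
  by rewrite !mulr_ge0// ?sumr_ge0// (le_trans ler01).
elim: n nN => [|n IH] nN; first by rewrite !big_ord0 !addr0 mulr0 mul0r addr0.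
rewrite !big_ord_recr /=.
have IHn := IH (ltnW nN); have En := energy nN.
have FM : 2 * S * F n * m n <= 2 * S * F n * M.
  by rewrite ler_wpM2l ?HM// !mulr_ge0// (le_trans ler01).
move: IHn; set s1 := \sum_(_ < n) _; set s2 := \sum_(_ < n) _; set s3 := \sum_(_ < n) _ => IHn.
have -> : 2 * S * (s3 + F n) * M = 2 * S * s3 * M + 2 * S * F n * M by ring.
by move: IHn En FM; lra.
Qed.

(** In use, [e] is the squared norm of the incoming trace, [j] the squared jump, [a] and [y] the
    viscous energies of the solution and of the datum, [F] the load, and [m] the root mean square
    over the slab. The differences of [e] telescope, and each load is multiplied by the one maximum
    [M], so no exponential factor appears. *)
Lemma gronwall : exists2 M, [/\ 0 <= M, forall n, (n < N)%N -> m n <= M &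
  M ^+ 2 <= 404 * S ^+ 6 * (D + Ft ^+ 2)] &
  e N + \sum_(k < N) (j k + a k) <= 406 * S ^+ 6 * (D + Ft ^+ 2).
Proof.
have [M [M0 HM MM]] := max_attained N.
have Ft0 : 0 <= Ft by apply: sumr_ge0.
have ys0 : 0 <= \sum_(n < N) y n by apply: sumr_ge0.
have D0 : 0 <= D by rewrite addr_ge0// e0.
have S0 : 0 <= S by rewrite (le_trans ler01).
have B0 : 0 <= D + 2 * S * Ft * M by rewrite addr_ge0// !mulr_ge0.
have M2 : M ^+ 2 <= 404 * S ^+ 6 * (D + Ft ^+ 2).
  case: MM => [->|[n nN Mn]].
    rewrite expr0n /=; apply: mulr_ge0; last by rewrite addr_ge0// sqr_ge0.
    by apply: mulr_ge0; [exact: ler0n|exact: exprn_ge0].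
  apply: peak_bound => //.
  apply: (@peak_bound0 R S _ Ft M (Num.sqrt (e n)) (F n) (a n) (y n)) => //.
  - rewrite sqr_sqrtr ?e0 1?ltnW//.
    apply: le_trans (energy_sum HM (ltnW nN)); rewrite lerDl.
    by apply: sumr_ge0 => k _; rewrite addr_ge0.
  - apply: le_trans (energy_sum HM nN); rewrite big_ord_recr /= ler_wpDl ?e0//.
    rewrite ler_wpDl ?lerDr//.
    by apply: sumr_ge0 => k _; rewrite addr_ge0.
  - rewrite (le_trans (term_le_sum y0 nN))// /D -addrA ler_wpDl ?e0// lerDl.
    by rewrite !mulr_ge0.
  - exact: term_le_sum.
  - by rewrite Mn; exact: lifted.
exists M; first by split.
exact: le_trans (energy_sum HM (leqnn N)) (total_bound S1 D0 M2).
Qed.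

End discrete_gronwall.

(** An inequality suffices and spares showing that the nodes missed by the slabs are negligible. *)
Lemma sum_integral_le disp (X : measurableType disp) (R : realType)
    (mu : {measure set X -> \bar R}) (D : set X) (N : nat) (E : 'I_N -> set X)
    (h : X -> \bar R) :
  measurable D -> (forall n, measurable (E n)) -> (forall n, E n `<=` D) ->
  trivIset setT E -> measurable_fun D h -> (forall x, D x -> (0 <= h x)%E) ->
  (\sum_(n < N) \int[mu]_(x in E n) h x <= \int[mu]_(x in D) h x)%E.
Proof.
move=> mD mE ED tE mh h0.
have UD : \big[setU/set0]_(n <- index_enum 'I_N) E n `<=` D.
  elim/big_ind : _ => //; first by move=> A B AD BD x [/AD|/BD].
have mU : measurable (\big[setU/set0]_(n <- index_enum 'I_N) E n).
  exact: bigsetU_measurable.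
rewrite -ge0_integral_bigsetU//.
- exact: ge0_subset_integral.
- exact: index_enum_uniq.
- exact: sub_trivIset tE.
- exact: measurable_funS mh.
- by move=> x /UD; exact: h0.
Qed.

(** * Stability *)

Section L2_forms.
Context {disp : measure_display} {X : measurableType disp} {R : realType} (q : nat).
Variables (mu : {measure set X -> \bar R}) (D : set X) (mD : measurable D).
Implicit Types (w z : 'I_q.+1 -> X -> R).
Local Notation H := (hilbert_mx q).

Lemma L2ip_le_form (K : R) f w : L2 mu D f -> (forall j, L2 mu D (w j)) ->
  (forall x, f x ^+ 2 <= K * quadf H (fun j => w j x)) ->
  L2ip mu D f f <= K * L2form mu D H w w.
Proof.
move=> Lf Lw fw; have [Ih ->] := L2form_quadf mD H Lw.
rewrite -RintegralZl// L2ipE; apply: le_Rintegral => //.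
- exact: L2_prod.
- exact: (integrableZl mD K Ih).
- by move=> x _; rewrite -expr2.
Qed.

Lemma L2form_hilbert_ge0 w : (forall j, L2 mu D (w j)) -> 0 <= L2form mu D H w w.
Proof.
move=> Lw; have [_ ->] := L2form_quadf mD H Lw.
by apply: Rintegral_ge0 => x _; exact: hilbert_form_ge0.
Qed.

Definition liftf (L : 'M[R]_q.+1) w : 'I_q.+1 -> X -> R :=
  fun k x => \sum_l L k l * w l x.

Lemma L2_liftf L w : (forall j, L2 mu D (w j)) -> forall k, L2 mu D (liftf L w k).
Proof. by move=> Lw k; apply: (L2_sum mD) => l; apply: (L2_Z mD). Qed.

Lemma L2form_lift_le (L : 'M[R]_q.+1) (K : R) w : (forall j, L2 mu D (w j)) ->
  (forall c, quadf H (mxlift L c) <= K * quadf H c) ->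
  L2form mu D H (liftf L w) (liftf L w) <= K * L2form mu D H w w.
Proof.
move=> Lw LK; have [Ih ->] := L2form_quadf mD H Lw.
have [Il ->] := L2form_quadf mD H (L2_liftf L Lw).
rewrite -RintegralZl//; apply: le_Rintegral => //.
- exact: (integrableZl mD K Ih).
- by move=> x _; exact: LK.
Qed.

Lemma L2form_dg_lift (L : 'M[R]_q.+1) w : (forall j, L2 mu D (w j)) ->
  dg_mx q *m L = H -> L2form mu D (dg_mx q) w (liftf L w) = L2form mu D H w w.
Proof.
move=> Lw LE; rewrite /L2form -LE; apply: eq_bigr => j _.
have E k : L2ip mu D (w j) (liftf L w k) = \sum_l L k l * L2ip mu D (w j) (w l).
  rewrite (L2ip_sumr mD) => [|l|//]; last exact: (L2_Z mD).
  by apply: eq_bigr => l _; rewrite L2ipC (L2ipZl mD) 1?L2ipC.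
under eq_bigr do rewrite E mulr_sumr.
rewrite exchange_big /=; apply: eq_bigr => l _; rewrite mxE mulr_suml.
by apply: eq_bigr => k _; rewrite mulrA.
Qed.

Lemma L2form_dg w : (forall j, L2 mu D (w j)) ->
  2 * L2form mu D (dg_mx q) w w =
  L2ip mu D (fun x => \sum_j w j x) (fun x => \sum_j w j x) +
  L2ip mu D (w ord0) (w ord0).
Proof.
move=> Lw; have [Id ->] := L2form_quadf mD (dg_mx q) Lw.
have Ls : L2 mu D (fun x => \sum_j w j x) by exact: (L2_sum mD).
rewrite -RintegralZl// !L2ipE -RintegralD//; try exact: L2_prod.
by apply: eq_Rintegral => x _; rewrite dg_form !expr2.
Qed.

Lemma L2ip_youngN f g : L2 mu D f -> L2 mu D g ->
  - L2ip mu D f g <= (L2ip mu D f f + L2ip mu D g g) / 2.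
Proof.
move=> Lf Lg; have Lf' := L2_Z mD (-1) Lf.
have := L2ip_young mD Lf' Lg; rewrite (L2ipZl mD _ Lf Lg) L2ipC.
by rewrite (L2ipZl mD _ Lf Lf') (L2ipC _ _ f) (L2ipZl mD _ Lf Lf) !mulN1r opprK.
Qed.

Lemma L2ip_sub f g : L2 mu D f -> L2 mu D g ->
  L2ip mu D (fun x => f x - g x) (fun x => f x - g x) =
  L2ip mu D f f - 2 * L2ip mu D g f + L2ip mu D g g.
Proof.
move=> Lf Lg; have Lfg := L2_B mD Lf Lg.
rewrite (L2ipBl mD Lf Lg Lfg) (L2ipBr mD Lf Lg Lf) (L2ipBr mD Lf Lg Lg).
rewrite (L2ipC _ _ f g).
have gen (x y z : R) : x - y - (y - z) = x - 2 * y + z by ring.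
exact: gen.
Qed.

End L2_forms.

(** * Arithmetic of the two slab estimates *)

Section real_steps.
Context {R : realType}.

(** Completing the square turns $2(A - c)$ into $e' - e + j_n$. After doubling, one of the two
    copies of [a] absorbs the viscous part of the data. *)
Lemma energy_step (A b c e e' a jn ft yt y S F m : R) :
  2 * A = e' + b -> jn = b - 2 * c + e -> A - c + a = ft + yt ->
  ft <= S * F * m -> yt <= (y + a) / 2 ->
  e' - e + jn + a <= 2 * S * F * m + y.
Proof.
move=> hA hj h hf hy; have -> : 2 * S * F * m = 2 * (S * F * m) by ring.
by move: hf; move: (S * F * m) => x hf; lra.
Qed.

(** The viscous pairing [gh] with the lifted function has no sign. It is bounded through [a] and
    [hh <= K * a] and stays on the right, to be controlled later by the energy estimate. *)
Lemma lifted_step (E c gh ft yt y a hh K S F m r : R) :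
  1 <= K -> K <= S -> 0 <= r -> 0 <= m -> 0 <= a -> 0 <= y ->
  E = m ^+ 2 -> E - c + gh = ft + yt -> c <= r * (K * m) -> - gh <= (a + hh) / 2 ->
  hh <= K * a -> ft <= S * F * m -> yt <= (y + hh) / 2 ->
  m ^+ 2 <= S * (r + F) * m + 2 * S * (a + y).
Proof.
move=> K1 KS r0 m0 a0 y0 EE h hc hg hh1 hf hy.
have P1 : r * (K * m) <= S * r * m.
  by rewrite mulrA [r * K]mulrC ler_wpM2r// ler_wpM2r.
have P2 : K * a <= S * a by rewrite ler_wpM2r.
have P3 : a <= S * a by rewrite ler_peMl// (le_trans K1).
have P4 : y <= S * y by rewrite ler_peMl// (le_trans K1).
have -> : S * (r + F) * m + 2 * S * (a + y) =
  S * r * m + S * F * m + 2 * (S * a) + 2 * (S * y) by ring.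
move: P1 P2 P3 P4 EE h hc hg hh1 hf hy a0 y0.
move: (S * r * m) (S * F * m) (S * a) (S * y) (r * (K * m)) (K * a) (m ^+ 2).
move=> x1 x2 x3 x4 x5 x6 x7; lra.
Qed.

Lemma sqrt_scale_le (K E x : R) : 1 <= K -> 0 <= E -> x <= K * E ->
  Num.sqrt x <= K * Num.sqrt E.
Proof.
move=> K1 E0 xK; rewrite (le_trans (ler_wsqrtr xK))//.
have K0 : 0 <= K by rewrite (le_trans ler01).
rewrite sqrtrM// ler_wpM2r ?sqrtr_ge0// -[leRHS]ger0_norm// -sqrtr_sqr ler_wsqrtr//.
by rewrite expr2 ler_peMl.
Qed.

(** The maximum in time [li] and the initial trace [b] each cost $K M^2$, hence $808 = 2 \cdot 404$;
    everything else is covered by the summed energy with its constant 406. *)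
Lemma final_step (S K M D D' Ft F eN sj sa j1 b li : R) :
  1 <= S -> 1 <= K -> 0 <= D -> D <= D' -> 0 <= Ft -> Ft <= F ->
  M ^+ 2 <= 404 * S ^+ 6 * (D + Ft ^+ 2) ->
  eN + (sj + sa) <= 406 * S ^+ 6 * (D + Ft ^+ 2) ->
  j1 <= sj -> b <= K * M ^+ 2 -> li <= K * M ^+ 2 ->
  li + sa + (eN + j1 + b) <= (808 * K + 406) * S ^+ 6 * (D' + F ^+ 2).
Proof.
move=> S1 K1 D0 DD Ft0 FF hM he hj hb hl.
have K0 : 0 <= K by rewrite (le_trans ler01).
have S6 : 0 <= S ^+ 6 by rewrite exprn_ge0// (le_trans ler01).
have Q1 : K * M ^+ 2 <= K * (404 * S ^+ 6 * (D + Ft ^+ 2)) by rewrite ler_wpM2l.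
have Q2 : D + Ft ^+ 2 <= D' + F ^+ 2.
  by rewrite lerD// ler_pXn2r ?nnegrE// (le_trans Ft0).
have Q3 : S ^+ 6 * (D + Ft ^+ 2) <= S ^+ 6 * (D' + F ^+ 2) by rewrite ler_wpM2l.
have Q4 : K * (S ^+ 6 * (D + Ft ^+ 2)) <= K * (S ^+ 6 * (D' + F ^+ 2)).
  by rewrite ler_wpM2l.
have E1 (x : R) : (808 * K + 406) * S ^+ 6 * x = 808 * (K * (S ^+ 6 * x)) + 406 * (S ^+ 6 * x).
  by ring.
have E2 (x : R) : K * (404 * S ^+ 6 * x) = 404 * (K * (S ^+ 6 * x)) by ring.
rewrite E1; move: he Q1; rewrite E2 -(mulrA 406) => he Q1.
move: Q1 Q3 Q4 he hj hb hl; clear.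
move: (K * (S ^+ 6 * (D + Ft ^+ 2))) (K * (S ^+ 6 * (D' + F ^+ 2))) (K * M ^+ 2)
  (S ^+ 6 * (D + Ft ^+ 2)) (S ^+ 6 * (D' + F ^+ 2)) => x1 x2 x3 x4 x5; lra.
Qed.

End real_steps.

(** * The stability estimate for a fixed discrete solution *)

Section stability.
Context {R : realType} (d q p : nat) (Omega : set 'rV[R]_d) (mO : measurable Omega).
Variables (T nu : R) (N : nat) (t : nat -> R) (Th : seq 'M[R]_(d.+1, d)).
Hypotheses (tp : time_partition T N t) (T0 : 0 < T) (nu0 : 0 < nu).
Local Notation X := 'rV[R]_d.
Local Notation XT := ('rV[R]_d * measurableTypeR R)%type.
Local Notation mu := (lebesgue_rV d).
Local Notation muT := (@st_measure R d).
Local Notation leb := (@lebesgue_measure R).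
Local Notation QT := (slab Omega 0 T).
Local Notation Qn n := (slab Omega (t n) (t n.+1)).
Local Notation H := (hilbert_mx q).
Variables (f Y u : XT -> R) (u0 : X -> R).
Variables (w : nat -> 'I_q.+1 -> X -> R) (g : nat -> 'I_q.+1 -> X -> 'rV[R]_d).
Hypotheses (mu_u : measurable_fun QT u) (uw : pw_rep Omega N t u w).
Hypothesis wg : forall n j, (n < N)%N -> H10_with Omega (w n j) (g n j).
Hypothesis Vw : forall n j, (n < N)%N -> Vh Omega Th p (w n j).
Hypotheses (Lf : L2 muT QT f) (LY : L2v muT QT (gradx Omega T Y)) (Lu0 : L2 mu Omega u0).
Hypothesis Beq : forall v, Vht Omega T N t Th p q v ->
  Bht Omega T N t nu u v =
    L2ip muT QT f v + nu * L2vip muT QT (gradx Omega T Y) (gradx Omega T v)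
    + L2ip mu Omega u0 (trace_right v 0).
Hypothesis Foo : (\int[leb]_(s in `]0%R, T[) L2norm mu Omega (slice f s) < +oo)%E.
Variables (L : 'M[R]_q.+1) (K : R).
Hypotheses (K1 : 1 <= K) (LE : dg_mx q *m L = H).
Hypothesis LK : forall c : 'I_q.+1 -> R,
  [/\ forall j, c j ^+ 2 <= K * quadf H c,
    forall k, mxlift L c k ^+ 2 <= K * quadf H c,
    quadf H (mxlift L c) <= K * quadf H c &
    forall r, 0 <= r <= 1 -> (\sum_(j < q.+1) r ^+ j * c j) ^+ 2 <= K * quadf H c].

Let mQT : measurable QT := measurable_slab mO 0 T.
Let mQn n : measurable (Qn n) := measurable_slab mO (t n) (t n.+1).
Let Lw n j : (n < N)%N -> L2 mu Omega (w n j).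
Proof. by move=> /(wg j) [[]]. Qed.
Let Lgi n i j : (n < N)%N -> L2 mu Omega (fun x => g n j x 0 i).
Proof. by move=> nN; have [[_ Lg _] _] := wg j nN; exact: Lg. Qed.
Let N0 : (0 < N)%N.
Proof.
rewrite lt0n; apply/eqP => N0; case: tp => t0 tN _.
by move: T0; rewrite -tN N0 t0 ltxx.
Qed.

(** The load is split into [q.+1] monomials in time, each of which costs a factor [K]. *)
Let S := q.+1%:R * K.
Let K0 : 0 <= K. Proof. by rewrite (le_trans ler01). Qed.
Let KS : K <= S. Proof. by rewrite ler_peMl// ler1n. Qed.
Let S1 : 1 <= S. Proof. exact: le_trans KS. Qed.

Let gi n i : 'I_q.+1 -> X -> R := fun j x => g n j x 0 i.
Let Yi i : XT -> R := fun z => gradx Omega T Y z 0 i.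
Let inc := incoming u0 w.
Let en n := L2ip mu Omega (inc n) (inc n).
Let jn n := L2ip mu Omega (fun x => w n ord0 x - inc n x) (fun x => w n ord0 x - inc n x).
Let an n := nu * \sum_i L2ip muT (Qn n) (tpoly (t n) (t n.+1) (gi n i))
                                        (tpoly (t n) (t n.+1) (gi n i)).
Let yn n := nu * \sum_i L2ip muT (Qn n) (Yi i) (Yi i).
Let Fn n := fine (\int[leb]_(s in `](t n), (t n.+1)[) L2norm mu Omega (slice f s))%E.
Let mn n := Num.sqrt (L2form mu Omega H (w n) (w n)).

Let LfQ n : (n < N)%N -> L2 muT (Qn n) f.
Proof. by move=> nN; apply: L2_subset Lf => //; exact: (slab_sub tp). Qed.

Let LYQ n i : (n < N)%N -> L2 muT (Qn n) (Yi i).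
Proof. by move=> nN; apply: L2_subset (LY i) => //; exact: (slab_sub tp). Qed.

Let Linc n : (n <= N)%N -> L2 mu Omega (inc n).
Proof. exact: (L2_incoming mO wg Lu0). Qed.

Let mnorm (s r : R) : `]s, r[ `<=` `]0, T[ ->
  measurable_fun (`]s, r[%classic : set (measurableTypeR R))
    (fun s => L2norm mu Omega (slice f s)).
Proof.
move=> sub; have [mf _] := Lf.
have := measurable_L2norm_slice mO mf; apply: measurable_funS => //.
Qed.

Let itv_sub n : (n < N)%N -> `](t n), (t n.+1)[ `<=` `]0, T[.
Proof.
move=> nN s /=; rewrite !in_itv /= => /andP[s1 s2].
rewrite (le_lt_trans (tp_ge0 tp (ltnW nN)) s1).
exact: lt_le_trans s2 (tp_leT tp nN).
Qed.

Let Fn_oo n : (n < N)%N ->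
  (\int[leb]_(s in `](t n), (t n.+1)[) L2norm mu Omega (slice f s) < +oo)%E.
Proof.
move=> nN; apply: le_lt_trans Foo; apply: ge0_subset_integral => //.
- exact: mnorm.
- by move=> s _; exact: Lnorm_ge0.
- exact: itv_sub.
Qed.

Let Fn0 n : 0 <= Fn n.
Proof. by apply: fine_ge0; apply: integral_ge0 => s _; exact: Lnorm_ge0. Qed.

(** Stated for any [z] whose coefficients are controlled by those of the solution, so that it serves
    both test functions. *)
Let fterm n (z : 'I_q.+1 -> X -> R) : (n < N)%N -> (forall j, L2 mu Omega (z j)) ->
  (forall j, L2ip mu Omega (z j) (z j) <= K * L2form mu Omega H (w n) (w n)) ->
  L2ip muT (Qn n) f (tpoly (t n) (t n.+1) z) <= S * Fn n * mn n.
Proof.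
move=> nN Lz zK; have ab := tp_lt tp nN.
rewrite (L2ip_sumr (mQn n)); [|by move=> j; exact: L2_sgX|exact: LfQ].
have -> : S * Fn n * mn n = \sum_(j < q.+1) Fn n * (K * mn n).
  rewrite sumr_const card_ord -[RHS]mulr_natl /S.
  by rewrite -!mulrA [K * (_ * _)]mulrCA.
apply: ler_sum => j _; rewrite (le_trans (ler_norm _))//.
apply: le_trans (L2ip_slab_le mO ab j (LfQ nN) (Lz j) (Fn_oo nN)) _.
apply: (ler_wpM2l (Fn0 n)); apply: (@sqrt_scale_le R K (L2form mu Omega H (w n) (w n))) => //.
by apply: L2form_hilbert_ge0 => // k; exact: Lw.
Qed.

Let an_form n : (n < N)%N -> nu * \sum_i (t n.+1 - t n) * L2form mu Omega H (gi n i) (gi n i) = an n.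
Proof.
move=> nN; rewrite /an; congr (_ * _); apply: eq_bigr => i _.
rewrite (L2ip_tpoly mO (tp_lt tp nN))// => j; exact: Lgi.
Qed.

Let energy n : (n < N)%N -> en n.+1 - en n + jn n + an n <= 2 * S * Fn n * mn n + yn n.
Proof.
move=> nN; have ab := tp_lt tp nN.
have Lwn j : L2 mu Omega (w n j) by exact: Lw.
have Lgn i j : L2 mu Omega (gi n i j) by exact: Lgi.
have LT i : L2 muT (Qn n) (tpoly (t n) (t n.+1) (gi n i)) by exact: (L2_tpoly mO ab).
have I := local_identity mO tp mu_u uw wg LY Lu0 Beq nN (fun j => Vw j nN) (fun j => wg j nN).
apply: (@energy_step _ (L2form mu Omega (dg_mx q) (w n) (w n))
  (L2ip mu Omega (w n ord0) (w n ord0)) (L2ip mu Omega (inc n) (w n ord0)) (en n) (en n.+1)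
  (an n) (jn n) (L2ip muT (Qn n) f (tpoly (t n) (t n.+1) (w n)))
  (nu * \sum_i L2ip muT (Qn n) (Yi i) (tpoly (t n) (t n.+1) (gi n i)))).
- exact: (L2form_dg mO Lwn).
- exact: (L2ip_sub mO (Lwn ord0) (Linc (ltnW nN))).
- by rewrite -(an_form nN); exact: I.
- apply: fterm => // j; apply: (L2ip_le_form mO) => // x.
  by have [+ _ _ _] := LK (fun j => w n j x); exact.
- rewrite /yn /an -mulrDr -mulrA ler_wpM2l ?(ltW nu0)// -big_split /= mulr_suml.
  apply: ler_sum => i _; exact: (L2ip_young (mQn n) (LYQ i nN) (LT i)).
Qed.

Let lifted n : (n < N)%N ->
  mn n ^+ 2 <= S * (Num.sqrt (en n) + Fn n) * mn n + 2 * S * (an n + yn n).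
Proof.
move=> nN; have ab := tp_lt tp nN.
have Lwn j : L2 mu Omega (w n j) by exact: Lw.
have Lgn i j : L2 mu Omega (gi n i j) by exact: Lgi.
have E0 : 0 <= L2form mu Omega H (w n) (w n) by exact: L2form_hilbert_ge0.
pose z := liftf L (w n); pose hi i := liftf L (gi n i).
(* As [L] mixes only time coefficients, lifting the gradients gives the gradients of the lifted
   function. *)
pose h : 'I_q.+1 -> X -> 'rV[R]_d := fun k x => \sum_l L k l *: g n l x.
have Lz j : L2 mu Omega (z j) by exact: (L2_liftf mO).
have Lhi i j : L2 mu Omega (hi i j) by exact: (L2_liftf mO).
have hE i : (fun j x => h j x 0 i) = hi i.
  apply/funext => j; apply/funext => x; rewrite /h summxE; apply: eq_bigr => l _.
  by rewrite mxE.
have LT i : L2 muT (Qn n) (tpoly (t n) (t n.+1) (gi n i)) by exact: (L2_tpoly mO ab).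
have LTh i : L2 muT (Qn n) (tpoly (t n) (t n.+1) (hi i)) by exact: (L2_tpoly mO ab).
have Vz j : Vh Omega Th p (z j).
  by apply: (Vh_sum mO (fun l => L j l)) => l; exact: Vw.
have zh j : H10_with Omega (z j) (h j).
  by apply: (H10_with_sum mO (fun l => L j l)) => l; exact: wg.
have zK j : L2ip mu Omega (z j) (z j) <= K * L2form mu Omega H (w n) (w n).
  apply: (L2ip_le_form mO) => // x.
  by have [_ + _ _] := LK (fun j => w n j x); exact.
have I := local_identity mO tp mu_u uw wg LY Lu0 Beq nN Vz zh.
apply: (@lifted_step _ (L2form mu Omega H (w n) (w n)) (L2ip mu Omega (inc n) (z ord0))
  (nu * \sum_i L2ip muT (Qn n) (tpoly (t n) (t n.+1) (gi n i)) (tpoly (t n) (t n.+1) (hi i)))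
  (L2ip muT (Qn n) f (tpoly (t n) (t n.+1) z))
  (nu * \sum_i L2ip muT (Qn n) (Yi i) (tpoly (t n) (t n.+1) (hi i))) (yn n) (an n)
  (nu * \sum_i L2ip muT (Qn n) (tpoly (t n) (t n.+1) (hi i)) (tpoly (t n) (t n.+1) (hi i))) K) => //.
- exact: sqrtr_ge0.
- by rewrite /an mulr_ge0 ?(ltW nu0)// sumr_ge0// => i _; exact: L2ip_ge0.
- by rewrite /yn mulr_ge0 ?(ltW nu0)// sumr_ge0// => i _; exact: L2ip_ge0.
- by rewrite sqr_sqrtr.
- rewrite -(L2form_dg_lift mO Lwn LE).
  have E1 i : L2ip muT (Qn n) (tpoly (t n) (t n.+1) (gi n i)) (tpoly (t n) (t n.+1) (hi i)) =
      (t n.+1 - t n) * L2form mu Omega H (gi n i) (fun j x => h j x 0 i).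
    by rewrite hE (L2ip_tpoly mO ab).
  rewrite (eq_bigr _ (fun i _ => E1 i)).
  have E2 i : L2ip muT (Qn n) (Yi i) (tpoly (t n) (t n.+1) (hi i)) =
      L2ip muT (Qn n) (Yi i) (tpoly (t n) (t n.+1) (fun j x => h j x 0 i)).
    by rewrite hE.
  by rewrite (eq_bigr _ (fun i _ => E2 i)); exact: I.
- apply: le_trans (L2ip_le mO (Linc (ltnW nN)) (Lz ord0)) _.
  apply: (ler_wpM2l (sqrtr_ge0 _)).
  exact: (@sqrt_scale_le R K (L2form mu Omega H (w n) (w n)) _ K1 E0 (zK ord0)).
- rewrite /an -mulrDr -mulrA -mulrN ler_wpM2l ?(ltW nu0)// -big_split /= mulr_suml -sumrN.
  by apply: ler_sum => i _; exact: (L2ip_youngN (mQn n) (LT i) (LTh i)).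
- rewrite /an mulrCA ler_wpM2l ?(ltW nu0)// mulr_sumr; apply: ler_sum => i _.
  rewrite !(L2ip_tpoly mO ab)// mulrCA ler_wpM2l ?subr_ge0 ?(ltW ab)//.
  by apply: (L2form_lift_le mO) => // c; have [] := LK c.
- exact: fterm.
- rewrite /yn -mulrDr -mulrA ler_wpM2l ?(ltW nu0)// -big_split /= mulr_suml.
  by apply: ler_sum => i _; exact: (L2ip_young (mQn n) (LYQ i nN) (LTh i)).
Qed.

Let trivI : trivIset setT (fun n : 'I_N => `](t n), (t n.+1)[%classic).
Proof.
apply/trivIsetP => m n _ _ mn_; apply/seteqP; split=> // s [/=].
rewrite !in_itv /= => sm sn; move: mn_; rewrite -val_eqE /=.
by rewrite (tp_inj tp (ltn_ord m) (ltn_ord n) sm sn) eqxx.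
Qed.

Let trivQ : trivIset setT (fun n : 'I_N => Qn n).
Proof.
apply/trivIsetP => m n _ _ mn_; apply/seteqP; split=> // -[x s] [/= [_ sm] [_ sn]].
have /trivIsetP/(_ m n I I mn_) := trivI.
by move=> /seteqP[/(_ s) + _]; apply.
Qed.

Let sumF : \sum_(n < N) Fn n <=
  fine (\int[leb]_(s in `]0%R, T[) L2norm mu Omega (slice f s))%E.
Proof.
have F0 : (0 <= \int[leb]_(s in `]0%R, T[) L2norm mu Omega (slice f s))%E.
  by apply: integral_ge0 => s _; exact: Lnorm_ge0.
rewrite -lee_fin fineK ?ge0_fin_numE// -sumEFin.
apply: le_trans (@sum_integral_le _ _ _ leb `]0, T[%classic N
  (fun n => `](t n), (t n.+1)[%classic) _ _ _ _ _ _ _) => //.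
- apply: lee_sum => n _; rewrite fineK// ge0_fin_numE; first exact: Fn_oo.
  by apply: integral_ge0 => s _; exact: Lnorm_ge0.
- by move=> n; exact: itv_sub.
- exact: mnorm.
- by move=> s _; exact: Lnorm_ge0.
Qed.

Let sumY : \sum_(n < N) yn n <= nu * L2vip muT QT (gradx Omega T Y) (gradx Omega T Y).
Proof.
rewrite -mulr_sumr ler_wpM2l ?(ltW nu0)// exchange_big /=; apply: ler_sum => i _.
rewrite -lee_fin -sumEFin -(L2norm_ip mQT (LY i)) L2norm_sqr.
apply: le_trans (@sum_integral_le _ _ _ muT QT N (fun n => Qn n)
  (fun z => (Yi i z ^+ 2)%:E) _ _ _ _ _ _) => //.
- apply: lee_sum => n _.
  by rewrite -(L2norm_ip (mQn n) (LYQ i (ltn_ord n))) L2norm_sqr.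
- by move=> n; exact: (slab_sub tp).
- by apply/measurable_EFinP; apply: measurable_funX; have [] := LY i.
- by move=> z _; rewrite lee_fin sqr_ge0.
Qed.

Let gradU : (nu%:E * L2vnorm2 muT QT (gradx Omega T u) = (\sum_(n < N) an n)%:E)%E.
Proof.
have HG := L2H10_pw mO tp mu_u uw wg.
have LG : L2v muT QT (pwg N t g) by case: HG.
have LU : L2v muT QT (gradx Omega T u) by case: (L2H10_gradx HG).
rewrite (L2vnorm2_ip mO LU) (L2vip_gradx mO HG LU) L2vipC (L2vip_gradx mO HG LG).
rewrite -EFinM -mulr_sumr; congr (_ * _)%:E; rewrite exchange_big /=.
apply: eq_bigr => i _.
have Lpw : L2 muT QT (pw N t (fun n => gi n i)).
  by apply: (L2_pw mO tp) => n j nN; exact: Lgi.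
transitivity (L2ip muT QT (pw N t (fun n => gi n i)) (pw N t (fun n => gi n i))).
  by apply: eq_L2ip => z _; rewrite mxE.
have ext (n : 'I_N) z : QT z -> ~ Qn n z ->
    (if t n < z.2 < t n.+1 then tpoly (t n) (t n.+1) (gi n i) z else 0) = 0.
  move=> [Oz _] nQ; case: ifPn => // sn; exfalso; apply: nQ; split=> //=.
have inn (n : 'I_N) z : Qn n z ->
    (if t n < z.2 < t n.+1 then tpoly (t n) (t n.+1) (gi n i) z else 0) =
    tpoly (t n) (t n.+1) (gi n i) z.
  by move=> [_ /=]; rewrite in_itv /= => ->.
(* Only the left factor is expanded; each of its pieces sees the right factor on its own slab, so no
   cross terms arise. *)
rewrite {1}/pw (L2ip_suml mQT) => [|n|//]; last first.
  apply: (L2_extend mQT (mQn n) (slab_sub tp (ltn_ord n)) (inn n) (ext n)).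
  apply: (L2_tpoly mO (tp_lt tp (ltn_ord n))) => j; exact: Lgi.
apply: eq_bigr => n _.
rewrite (L2ip_extend muT (slab_sub tp (ltn_ord n)) (inn n) (ext n)).
apply: eq_L2ip => // -[x s] [/= _]; rewrite in_itv /= => sn.
exact: (pwE tp _ _ (ltn_ord n) sn).
Qed.

Let jumps : jump_seminorm2 Omega T N t u =
  (en N + \sum_(1 <= n < N) jn n + L2ip mu Omega (w 0%N ord0) (w 0%N ord0))%:E.
Proof.
have [t0 tN _] := tp.
rewrite /jump_seminorm2 !EFinD -sumEFin; congr (_ + _ + _)%E.
- have [N' NE] : exists N', N = N'.+1 by exists N.-1; rewrite prednK.
  have N'N : (N' < N)%N by rewrite NE.
  rewrite (@eq_L2norm _ _ _ mu Omega _ (inc N)); first exact: (L2norm_ip mO (Linc (leqnn N))).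
  move=> x Ox; rewrite -tN NE /inc /=; exact: (trace_left_rep tp uw N'N Ox).
- rewrite !big_nat; apply: eq_bigr => -[//|n] /andP[_ nN].
  rewrite (@eq_L2norm _ _ _ mu Omega _ (fun x => w n.+1 ord0 x - inc n.+1 x)).
    apply: (L2norm_ip mO); apply: (L2_B mO); [exact: Lw|exact: Linc (ltnW nN)].
  by move=> x Ox; exact: (jump_rep tp u0 uw nN Ox).
- rewrite (@eq_L2norm _ _ _ mu Omega _ (w 0%N ord0)).
    by apply: (L2norm_ip mO); exact: Lw.
  by move=> x Ox; rewrite -t0; exact: (trace_right_rep tp uw N0 Ox).
Qed.

(** The last bound of [LK] is applied at each point of space, at the rescaled time of the slice,
    then integrated. The nodes are the exceptional null set of the essential supremum. *)
Let Linfty M : (forall n, (n < N)%N -> mn n <= M) -> 0 <= M ->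
  (LrL2norm Omega T +oo u ^+ 2 <= (K * M ^+ 2)%:E)%E.
Proof.
move=> HM M0; have KM : 0 <= K * M ^+ 2 by rewrite mulr_ge0// sqr_ge0.
suff le : (LrL2norm Omega T +oo u <= (Num.sqrt (K * M ^+ 2))%:E)%E.
  have L0 : (0 <= LrL2norm Omega T +oo u)%E by exact: Lnorm_ge0.
  by rewrite -[K * M ^+ 2]sqr_sqrtr// EFin_expe (lee_sqr L0)// lee_fin sqrtr_ge0.
rewrite /LrL2norm unlock; case: ifPn => _; last by rewrite lee_fin sqrtr_ge0.
apply/ess_supP; exists (nodes N t); split.
- exact: measurable_nodes.
- exact: nodes_null.
move=> s /= nle; apply: contrapT => ns; apply: nle.
rewrite patchE; case: ifPn => [|_]; last by rewrite abse0 lee_fin sqrtr_ge0.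
move=> /set_mem /=; rewrite in_itv /= => s0T.
have [n nN sn] := tp_cover tp s0T ns.
rewrite gee0_abs; last exact: Lnorm_ge0.
have Lwn j : L2 mu Omega (w n j) by exact: Lw.
pose v x := \sum_(j < q.+1) sg (t n) (t n.+1) s ^+ j * w n j x.
have Lv : L2 mu Omega v by apply: (L2_sum mO) => j; exact: (L2_Z mO).
rewrite (@eq_L2norm _ _ _ mu Omega _ v); last first.
  by move=> x Ox; rewrite /slice (uw nN).
rewrite (L2norm_sqrt mO Lv) lee_fin ler_wsqrtr//.
apply: (@le_trans _ _ (K * L2form mu Omega H (w n) (w n))).
  apply: (L2ip_le_form mO) => // x; have [_ _ _] := LK (fun j => w n j x); apply.
  exact: (sg_bounds (tp_lt tp nN)).
rewrite ler_wpM2l// -[leLHS]sqr_sqrtr; last exact: L2form_hilbert_ge0.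
by rewrite ler_pXn2r ?nnegrE ?sqrtr_ge0//; exact: HM.
Qed.

Lemma stability_bound :
  (LrL2norm Omega T +oo u ^+ 2 + nu%:E * L2vnorm2 muT QT (gradx Omega T u)
   + jump_seminorm2 Omega T N t u
   <= ((808 * K + 406) * S ^+ 6 *
       (L2ip mu Omega u0 u0 + nu * L2vip muT QT (gradx Omega T Y) (gradx Omega T Y)
        + fine (\int[leb]_(s in `]0%R, T[) L2norm mu Omega (slice f s))%E ^+ 2))%:E)%E.
Proof.
have [M [M0 HM M2] EN] := @gronwall R S N en jn an yn Fn mn S1
  (fun n _ => L2ip_ge0 _ _ _) (fun n => L2ip_ge0 _ _ _)
  (fun n => mulr_ge0 (ltW nu0) (sumr_ge0 _ (fun i _ => L2ip_ge0 _ _ _)))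
  (fun n => mulr_ge0 (ltW nu0) (sumr_ge0 _ (fun i _ => L2ip_ge0 _ _ _)))
  Fn0 (fun n => sqrtr_ge0 _) energy lifted.
rewrite gradU jumps.
apply: le_trans (leeD (leeD (Linfty HM M0) (lexx _)) (lexx _)) _.
rewrite -!EFinD lee_fin; move: EN; rewrite big_split /= => EN.
have Lwn j : L2 mu Omega (w 0%N j) by exact: Lw.
apply: (final_step S1 K1 _ _ _ sumF M2 EN _ _ (lexx _)).
- by apply: addr_ge0; [exact: L2ip_ge0|apply: sumr_ge0 => n _; rewrite mulr_ge0 ?(ltW nu0)//;
    apply: sumr_ge0 => i _; exact: L2ip_ge0].
- by rewrite lerD2l.
- by apply: sumr_ge0 => n _.
(* The energy sum also contains the mismatch between [u0] and the initial trace, which is dropped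
   here; the seminorm has the initial trace itself, bounded next through [M]. *)
- rewrite -(big_mkord xpredT jn) [leRHS](big_ltn N0) lerDr; exact: L2ip_ge0.
- apply: (@le_trans _ _ (K * L2form mu Omega H (w 0%N) (w 0%N))).
    apply: (L2ip_le_form mO) => // x.
    by have [+ _ _ _] := LK (fun j => w 0%N j x); exact.
  rewrite ler_wpM2l// -[leLHS]sqr_sqrtr; last exact: L2form_hilbert_ge0.
  by rewrite ler_pXn2r ?nnegrE ?sqrtr_ge0//; exact: HM.
Qed.

End stability.

(** Disposes of the case of an infinite load norm, in which the right-hand side of the estimate is
    infinite. *)
Lemma gt0_muley_sum (R : realType) (c a b y : R) : 0 < c ->
  (c%:E * (+oo ^+ 2 + a%:E * b%:E + y%:E) = +oo)%E.
Proof. by move=> c0; rewrite /= gt0_muley ?lte_fin. Qed.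

Lemma mul_fin_sum (R : realType) (c a b y : R) (P : \bar R) : P \is a fin_num ->
  (c%:E * (P ^+ 2 + a%:E * b%:E + y%:E) = (c * (y + a * b + fine P ^+ 2))%:E)%E.
Proof.
case: P => // r _; rewrite expe2.
have -> : c * (y + a * b + fine r%:E ^+ 2) = c * (r * r + a * b + y).
  by rewrite /=; ring.
by [].
Qed.

Theorem proposition4p2 (R : realType) (q : nat) :
  exists2 C : R, 0 < C &
  forall (d p N : nat) (Omega : set 'rV[R]_d) (T gamma nu : R)
    (Th : seq 'M[R]_(d.+1, d)) (t : nat -> R)
    (f Upsilon u : 'rV[R]_d * measurableTypeR R -> R) (u0 : 'rV[R]_d -> R),
  (1 <= d <= 3)%N -> (1 <= p)%N -> 0 < T -> 0 < nu ->
  polytopic_domain Omega ->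
  conforming_mesh Omega Th -> shape_regular gamma Th ->
  time_partition T N t ->
  L2 (@st_measure R d) (slab Omega 0 T) f ->
  L2 (lebesgue_rV d) Omega u0 ->
  L2H10 Omega T Upsilon ->
  Vht Omega T N t Th p q u ->
  (forall v, Vht Omega T N t Th p q v ->
    Bht Omega T N t nu u v =
      L2ip (@st_measure R d) (slab Omega 0 T) f v
      + nu * L2vip (@st_measure R d) (slab Omega 0 T)
               (gradx Omega T Upsilon) (gradx Omega T v)
      + L2ip (lebesgue_rV d) Omega u0 (trace_right v 0)) ->
  (LrL2norm Omega T +oo u ^+ 2
   + nu%:E * L2vnorm2 (@st_measure R d) (slab Omega 0%R T) (gradx Omega T u)
   + jump_seminorm2 Omega T N t u
   <= C%:E * (LrL2norm Omega T 1%:E f ^+ 2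
              + nu%:E * L2vnorm2 (@st_measure R d) (slab Omega 0%R T)
                          (gradx Omega T Upsilon)
              + L2norm (lebesgue_rV d) Omega u0 ^+ 2))%E.
Proof.
have [L [K K1 [LE LK]]] := @quadf_constants R q.
pose C := (808 * K + 406) * (q.+1%:R * K) ^+ 6.
have C0 : 0 < C.
  have K0 : 0 < K := lt_le_trans ltr01 K1.
  have K2 : 0 < 808 * K + 406 by lra.
  by apply: mulr_gt0 => //; rewrite exprn_gt0// mulr_gt0.
exists C => // d p N Omega T gamma nu Th t f Y u u0 _ _ T0 nu0 [_ _ OE _] _ _ tp Lf Lu0.
move=> [GY HY] Vu Beq.
(* A polytopic domain is the interior of its closure, hence open. *)
have mO : measurable Omega.
  by rewrite OE; apply: open_rV_measurable; exact: open_interior.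
have LY : L2v (@st_measure R d) (slab Omega 0 T) (gradx Omega T Y).
  by case: (L2H10_gradx HY).
have [w [Vw uw]] := Vht_pw_rep mO tp Vu.
(* Membership in [Vh] only asserts that a gradient exists; one is fixed for each coefficient, with a
   default beyond the last slab. *)
have ex_g n j : exists G, (n < N)%N -> H10_with Omega (w n j) G.
  have [nN|_] := boolP (n < N)%N; last by exists (fun=> 0).
  by have [[G HG] _] := Vw n j nN; exists G.
have ex_gn n : exists gn : 'I_q.+1 -> 'rV[R]_d -> 'rV[R]_d,
    forall j, (n < N)%N -> H10_with Omega (w n j) (gn j).
  by have [gn gnP] := choice (ex_g n); exists gn.
have [g wg] := choice ex_gn.
have [mu_u _] := Vu.
pose Phi := (\int[lebesgue_measure]_(s in `]0%R, T[)
  L2norm (lebesgue_rV d) Omega (slice f s))%E.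
have Phi0 : (0 <= Phi)%E by apply: integral_ge0 => s _; exact: Lnorm_ge0.
have PhiE : LrL2norm Omega T 1%:E f = Phi.
  rewrite /LrL2norm Lnorm1 [RHS]integral_mkcond; apply: eq_integral => s _.
  rewrite !patchE; case: ifPn => _; last by rewrite abse0.
  by rewrite gee0_abs//; exact: Lnorm_ge0.
rewrite PhiE (L2vnorm2_ip mO LY) (L2norm_ip mO Lu0).
have Y0 : 0 <= nu * L2vip (@st_measure R d) (slab Omega 0 T)
    (gradx Omega T Y) (gradx Omega T Y).
  by rewrite mulr_ge0 ?(ltW nu0)// sumr_ge0// => i _; exact: L2ip_ge0.
have U0 := L2ip_ge0 (lebesgue_rV d) Omega u0.
have [PhiT|] := ltP Phi +oo%E; last first.
  by rewrite leye_eq => /eqP ->; rewrite gt0_muley_sum// leey.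
apply: le_trans (stability_bound mO tp T0 nu0 mu_u uw wg Vw Lf LY Lu0 Beq PhiT K1 LE LK) _.
rewrite -/Phi -/C mul_fin_sum ?ge0_fin_numE//.
Qed.
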